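(* The algorithm described below computes simulation equivalence $P_{\mathrm{sim}}$ on $\mathcal{K}$ in space $O(|\Sigma|+|P_{\mathrm{sim}}|^2)$ and in time $O(|P_{\mathrm{sim}}|^2 \cdot (|P_{\mathrm{sim}}|^2 + |\to|))$.
   Context: Let $\mathcal{K}=(\Sigma,\to,\ell)$ be a finite Kripke structure with total transition relation $\to$, $\mathrm{pre}(Y)=\{a~|~\exists b\in Y.\,a\to b\}$. A simulation is a relation $R$ such that $sRs'$ implies $\ell(s')\subseteq\ell(s)$ and for every $s\to t$ there is $s'\to t'$ with $tRt'$; $s\sim_{\mathrm{sim}}s'$ iff there are simulations $R_1,R_2$ with $sR_1s'$ and $s'R_2s$, and $P_{\mathrm{sim}}$ is the corresponding partition. The algorithm maintains a disjunctive abstract domain $A$ of $\wp(\Sigma)$ (an image closed under arbitrary unions and intersections), represented by the partition $\mathrm{par}(A)$ of states with equal abstraction together with the partial order $B_1\unlhd_A B_2$ iff $\gamma(\alpha(B_1))\subseteq\gamma(\alpha(B_2))$ on its blocks (so that $\gamma(\alpha(S))$ is the union of blocks below some block meeting $S$). Starting from the disjunctive domain generated by the label classes, it scans the list of blocks $B$ of the current partition; for each, it computes $X=\gamma(\alpha(B))$ and $\mathrm{pre}(X)$, refines $A$ to the disjunctive domain generated by $\gamma(A)\cup\{\mathrm{pre}(X)\}$ by splitting each block into its parts inside/outside $\mathrm{pre}(X)$ and updating the order (for a new block $B'$ with parent block $\mathrm{parent}(B')$: if $B'\cap \mathrm{pre}(X)=\varnothing$ then $C'\unlhd B'$ iff $C'\subseteq\gamma(\alpha(\mathrm{parent}(B')))$,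 otherwise iff $C'\subseteq\gamma(\alpha(\mathrm{parent}(B')))\cap \mathrm{pre}(X)$), and moves blocks whose image changed to the end of the list. On termination the current partition is output. This is an implementation of the generalized Paige–Tarjan algorithm instantiated on disjunctive abstract domains with the operator $\mathrm{pre}$.
   Formalization: The initial domain is the label classes ordered by label inclusion (image of s = states whose label is included in that of s), since with all unions of label classes the output can be finer than P_sim; the bounds are stated for nonempty Σ. *)

(* Defs.v *)
From mathcomp Require Import all_boot.

Set Implicit Arguments.
Unset Strict Implicit.
Unset Printing Implicit Defensive.

(** * Kripke structures and simulation equivalence *)

Record kripke := Kripke {
  atom : finType;
  world : finType;
  trans : rel world;
  label : world -> {set atom};
  trans_total : forall s, exists t, trans s t
}.

Definition transitions (K : kripke) : {set world K * world K} :=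
  [set st | trans st.1 st.2].

Definition simulation (K : kripke) (R : {set world K * world K}) : bool :=
  [forall s, forall s', ((s, s') \in R) ==>
     ((label s' \subset label s) &&
      [forall t, trans s t ==>
         [exists t', trans s' t' && ((t, t') \in R)]])].

Definition sim_equiv (K : kripke) : rel (world K) := fun s s' =>
  [exists R1 : {set world K * world K}, simulation R1 && ((s, s') \in R1)] &&
  [exists R2 : {set world K * world K}, simulation R2 && ((s', s) \in R2)].

Definition P_sim (K : kripke) : {set {set world K}} :=
  equivalence_partition (@sim_equiv K) [set: world K].

(** * A random-access machine

    While programs over finitely many scalar variables and finitely many
    zero-initialised, dynamically growing arrays of natural numbers, with a
    read-only input.

    - Time: every elementary operation (each node of an evaluated expression,
      each assignment, each test) costs 1.  Comparing two label sets is one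
      elementary operation, as the bounds do not mention the set of atoms.
    - Space: one cell per scalar and per allocated array entry.  The input is
      read-only and is not counted.  *)

Record input := Input {
  nstates : nat;
  edges : seq (nat * nat);
  label_sub : nat -> nat -> bool
}.

Inductive var :=
  vNum | vNum' | vPos | vPos' | vLen | vCur | vI | vJ | vVal.

Inductive arr :=
  aBlk | aRep | aRel | aRel' | aLst | aLst' | aImg | aPre | aMeet | aDiff
| aNew | aPar | aInPre | aChg.

Scheme Equality for var.
Scheme Equality for arr.

Definition vars : seq var :=
  [:: vNum; vNum'; vPos; vPos'; vLen; vCur; vI; vJ; vVal].

Definition arrs : seq arr :=
  [:: aBlk; aRep; aRel; aRel'; aLst; aLst'; aImg; aPre; aMeet; aDiff;
      aNew; aPar; aInPre; aChg].

Inductive expr :=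
| Num of nat
| Var of var
| Get of arr & expr
| Add of expr & expr
| Mul of expr & expr
| Lt of expr & expr
| Eq of expr & expr
| And of expr & expr
| Not of expr
| NStates
| NEdges
| Src of expr                 (* source of the e-th transition *)
| Dst of expr                 (* target of the e-th transition *)
| LabelSub of expr & expr.    (* is the label of e1 included in that of e2? *)

Inductive cmd :=
| Assign of var & expr
| Store of arr & expr & expr
| Seq of cmd & cmd
| If of expr & cmd & cmd
| While of expr & cmd
| Skip.

Record state := State { reg : var -> nat; mem : arr -> seq nat }.

Definition init_state : state := State (fun=> 0) (fun=> [::]).

Definition set_reg (st : state) (x : var) (n : nat) : state :=
  State (fun y => if var_beq y x then n else reg st y) (mem st).

(* [set_nth] pads an array with zeros up to the written index and never
   shrinks it, so the size of an array is its high-water mark. *)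
Definition set_mem (st : state) (a : arr) (i n : nat) : state :=
  State (reg st)
        (fun b => if arr_beq b a then set_nth 0 (mem st a) i n else mem st b).

(* Allocated space never decreases along an execution: the space of the final
   state is the peak space of the run. *)
Definition space (st : state) : nat :=
  size vars + \sum_(a <- arrs) size (mem st a).

Fixpoint eval (inp : input) (st : state) (e : expr) : nat :=
  match e with
  | Num n => n
  | Var x => reg st x
  | Get a e1 => nth 0 (mem st a) (eval inp st e1)
  | Add e1 e2 => eval inp st e1 + eval inp st e2
  | Mul e1 e2 => eval inp st e1 * eval inp st e2
  | Lt e1 e2 => eval inp st e1 < eval inp st e2
  | Eq e1 e2 => eval inp st e1 == eval inp st e2
  | And e1 e2 => (eval inp st e1 != 0) && (eval inp st e2 != 0)
  | Not e1 => eval inp st e1 == 0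
  | NStates => nstates inp
  | NEdges => size (edges inp)
  | Src e1 => (nth (0, 0) (edges inp) (eval inp st e1)).1
  | Dst e1 => (nth (0, 0) (edges inp) (eval inp st e1)).2
  | LabelSub e1 e2 => label_sub inp (eval inp st e1) (eval inp st e2)
  end.

Fixpoint ecost (e : expr) : nat :=
  match e with
  | Num _ | Var _ | NStates | NEdges => 1
  | Get _ e1 | Not e1 | Src e1 | Dst e1 => (ecost e1).+1
  | Add e1 e2 | Mul e1 e2 | Lt e1 e2 | Eq e1 e2 | And e1 e2
  | LabelSub e1 e2 => (ecost e1 + ecost e2).+1
  end.

(* [exec inp c st st' t]: run on input [inp] from [st], the command [c] halts
   in [st'] after [t] elementary operations. *)
Inductive exec (inp : input) : cmd -> state -> state -> nat -> Prop :=
| ExecAssign x e st :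
    exec inp (Assign x e) st (set_reg st x (eval inp st e)) (ecost e).+1
| ExecStore a e1 e2 st :
    exec inp (Store a e1 e2) st
      (set_mem st a (eval inp st e1) (eval inp st e2))
      (ecost e1 + ecost e2).+1
| ExecSeq c1 c2 st1 st2 st3 t1 t2 :
    exec inp c1 st1 st2 t1 -> exec inp c2 st2 st3 t2 ->
    exec inp (Seq c1 c2) st1 st3 (t1 + t2)
| ExecIf e c1 c2 st st' t :
    exec inp (if eval inp st e != 0 then c1 else c2) st st' t ->
    exec inp (If e c1 c2) st st' (ecost e + t).+1
| ExecWhileStop e c st :
    eval inp st e = 0 ->
    exec inp (While e c) st st (ecost e).+1
| ExecWhileLoop e c st1 st2 st3 t1 t2 :
    eval inp st1 e != 0 ->
    exec inp c st1 st2 t1 -> exec inp (While e c) st2 st3 t2 ->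
    exec inp (While e c) st1 st3 (ecost e + t1 + t2).+1
| ExecSkip st : exec inp Skip st st 1.

Lemma exec_det inp c st st1 st2 t1 t2 :
  exec inp c st st1 t1 -> exec inp c st st2 t2 -> st1 = st2 /\ t1 = t2.
Proof.
move=> ex; elim: ex st2 t2 => {c st st1 t1}.
- by move=> x e st st2 t2 ex2; inversion ex2; subst.
- by move=> a e1 e2 st st2 t2 ex2; inversion ex2; subst.
- move=> c1 c2 sa sb sc ta tb _ IH1 _ IH2 st2 t2 ex2; inversion ex2; subst.
  by case: (IH1 _ _ ltac:(eassumption)) => ? ?; subst;
     case: (IH2 _ _ ltac:(eassumption)) => ? ?; subst.
- move=> e c1 c2 sa sb t _ IH st2 t2 ex2; inversion ex2; subst.
  by case: (IH _ _ ltac:(eassumption)) => ? ?; subst.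
- move=> e c st e0 st2 t2 ex2; inversion ex2; subst => //.
  by match goal with H : is_true (_ != 0) |- _ => rewrite e0 in H end.
- move=> e c sa sb sc ta tb e1 _ IH1 _ IH2 st2 t2 ex2; inversion ex2; subst.
    by match goal with H : eval _ _ _ = 0 |- _ => rewrite H in e1 end.
  by case: (IH1 _ _ ltac:(eassumption)) => ? ?; subst;
     case: (IH2 _ _ ltac:(eassumption)) => ? ?; subst.
- by move=> st st2 t2 ex2; inversion ex2; subst.
Qed.

Lemma exec_space inp c st st' t : exec inp c st st' t -> space st <= space st'.
Proof.
elim=> {c st st' t} //.
- move=> a e1 e2 st; rewrite leq_add2l leq_sum // => b _ /=.
  case: ifP => // /internal_arr_dec_bl ->.
  by rewrite size_set_nth leq_maxr.
- by move=> c1 c2 sa sb sc ta tb _ + _; apply: leq_trans.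
- by move=> e c sa sb sc ta tb _ _ + _; apply: leq_trans.
Qed.

Coercion Num : nat >-> expr.
Coercion Var : var >-> expr.

Declare Scope prog_scope.
Delimit Scope prog_scope with prog.
Bind Scope prog_scope with expr cmd.
Notation "a .[ e ]" := (Get a e%prog) : prog_scope.
Notation "e1 + e2" := (Add e1%prog e2%prog) : prog_scope.
Notation "e1 * e2" := (Mul e1%prog e2%prog) : prog_scope.
Notation "e1 < e2" := (Lt e1%prog e2%prog) : prog_scope.
Notation "e1 == e2" := (Eq e1%prog e2%prog) : prog_scope.
Notation "e1 && e2" := (And e1%prog e2%prog) : prog_scope.
Notation "~~ e" := (Not e%prog) : prog_scope.
Notation "x ::= e" := (Assign x e%prog)
  (at level 85, no associativity) : prog_scope.
Notation "a @[ e1 ] ::= e2" := (Store a e1%prog e2%prog)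
  (at level 85, e1 at level 200, no associativity,
   format "a  @[ e1 ]  ::=  e2") : prog_scope.
Notation "c1 ;; c2" := (Seq c1%prog c2%prog)
  (at level 90, right associativity) : prog_scope.

Definition For (x : var) (bound : expr) (c : cmd) : cmd :=
  (x ::= 0 ;; While (x < bound) (c ;; x ::= x + 1))%prog.

(** * The algorithm

    A disjunctive abstract domain [A] is represented as follows.  The blocks of
    [par(A)] are numbered from 0 to [vNum - 1]; [aBlk.[s]] is the block of the
    state [s]; the [vNum * vNum] Boolean matrix [aRel] is the order, the entry
    [aRel.[c * vNum + b]] telling whether block [c] is below block [b], that is,
    whether [c] is included in the image gamma(alpha(b)).  The list of blocks is
    [aLst], and [vPos] is the position reached by the scan. *)

Local Open Scope prog_scope.

(* The blocks of the initial domain are the label classes.  The simulators [c]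
   of [b] have smaller labels, so the initial image of [b] consists of the
   classes whose label is included in that of [b]. *)
Definition initialize : cmd :=
  vNum ::= 0 ;;
  For vI NStates (
    vVal ::= vNum ;;
    For vJ vNum (
      If (LabelSub vI aRep.[vJ] && LabelSub aRep.[vJ] vI)
         (vVal ::= vJ) Skip) ;;
    aBlk @[vI] ::= vVal ;;
    If (vVal == vNum)
       (aRep @[vNum] ::= vI ;; vNum ::= vNum + 1) Skip) ;;
  For vI vNum (
    aLst @[vI] ::= vI ;;
    For vJ vNum (
      aRel @[vI * vNum + vJ] ::= LabelSub aRep.[vI] aRep.[vJ])) ;;
  vPos ::= 0.

(* X = gamma(alpha(B)), as a set of blocks, for B = [vCur]. *)
Definition compute_image : cmd :=
  For vI vNum (aImg @[vI] ::= aRel.[vI * vNum + vCur]).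

(* pre(X), as a set of states. *)
Definition compute_pre : cmd :=
  For vI NStates (aPre @[vI] ::= 0) ;;
  For vI NEdges (
    If (aImg.[aBlk.[Dst vI]]) (aPre @[Src vI] ::= 1) Skip).

(* If the block [b] meets both pre(X) and its complement, then the part outside
   pre(X) keeps the number [b] and the part inside gets a fresh number.  After
   the split, [vNum'] is the number of blocks, [aPar] maps a new block to its
   parent and [aInPre] tells which new blocks are included in pre(X). *)
Definition split : cmd :=
  For vI vNum (aMeet @[vI] ::= 0 ;; aDiff @[vI] ::= 0) ;;
  For vI NStates (
    If (aPre.[vI]) (aMeet @[aBlk.[vI]] ::= 1) (aDiff @[aBlk.[vI]] ::= 1)) ;;
  vNum' ::= vNum ;;
  For vI vNum (
    aPar @[vI] ::= vI ;;
    aNew @[vI] ::= vI ;;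
    aInPre @[vI] ::= aMeet.[vI] && ~~ aDiff.[vI] ;;
    If (aMeet.[vI] && aDiff.[vI])
       (aNew @[vI] ::= vNum' ;;
        aPar @[vNum'] ::= vI ;;
        aInPre @[vNum'] ::= 1 ;;
        vNum' ::= vNum' + 1) Skip) ;;
  For vI NStates (
    If (aPre.[vI]) (aBlk @[vI] ::= aNew.[aBlk.[vI]]) Skip).

(* [aChg] records the new blocks whose image differs from that of their parent:
   those for which some block is lost. *)
Definition update_order : cmd :=
  For vJ vNum' (
    aChg @[vJ] ::= 0 ;;
    For vI vNum' (
      vVal ::= aRel.[aPar.[vI] * vNum + aPar.[vJ]] ;;
      If (vVal && (aInPre.[vJ] && ~~ aInPre.[vI]))
         (vVal ::= 0 ;; aChg @[vJ] ::= 1) Skip ;;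
      aRel' @[vI * vNum' + vJ] ::= vVal)) ;;
  For vI (vNum' * vNum') (aRel @[vI] ::= aRel'.[vI]).

(* The blocks whose image is unchanged keep their relative order, and the others
   go to the end of the list; the scan resumes after the last kept block among
   those scanned so far. *)
Definition update_list : cmd :=
  vLen ::= 0 ;;
  vPos' ::= 0 ;;
  For vI vNum (
    If (aChg.[aLst.[vI]]) Skip (
      aLst' @[vLen] ::= aLst.[vI] ;;
      vLen ::= vLen + 1 ;;
      If (vI < vPos + 1) (vPos' ::= vPos' + 1) Skip)) ;;
  For vI vNum' (
    If (aChg.[vI]) (aLst' @[vLen] ::= vI ;; vLen ::= vLen + 1) Skip) ;;
  For vI vNum' (aLst @[vI] ::= aLst'.[vI]) ;;
  vNum ::= vNum' ;;
  vPos ::= vPos'.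

Definition sim_algorithm : cmd :=
  initialize ;;
  While (vPos < vNum) (
    vCur ::= aLst.[vPos] ;;
    compute_image ;;
    compute_pre ;;
    split ;;
    update_order ;;
    update_list).

Local Close Scope prog_scope.

(** * Running the algorithm on a Kripke structure *)

Definition num (K : kripke) (s : world K) : nat := enum_rank s.

(* [E] lists the transitions, in any order. *)
Definition input_of (K : kripke) (E : seq (world K * world K)) : input := {|
  nstates := #|world K|;
  edges := [seq (num st.1, num st.2) | st <- E];
  label_sub := fun i j =>
    let labels := [seq label s | s <- enum (world K)] in
    nth set0 labels i \subset nth set0 labels j
|}.

Definition output (K : kripke) (st : state) : {set {set world K}} :=
  preim_partition (fun s : world K => nth 0 (mem st aBlk) (num s))
                  [set: world K].

(* Main.v *)
Require Import Defs.
From mathcomp Require Import all_boot.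
From mathcomp Require Import zify.
Import Defs.

Set Implicit Arguments.
Unset Strict Implicit.
Unset Printing Implicit Defensive.

(** Correctness.  The order of the domain always contains the simulation
    preorder: an image is closed under simulation, hence so is its set of
    predecessors.  Conversely, once [pre X] is expressible in the domain for
    every image [X], the order itself is a simulation: if [s'] lies in the image
    of [s] and [s] moves to [t], then [s] is in [pre X] for [X] the image of
    [t], hence so is [s'].

    Complexity.  Let the weight of a configuration be the number of pairs of
    simulation classes related by the order, plus the number of blocks not yet
    scanned.  A scan removes one block from the second term, and each block that
    it moves to the end of the list has lost a pair of classes, and these pairs
    are distinct; so the weight decreases at every scan, and there are at most
    [p ^ 2 + p] scans for [p] simulation classes.  Every scan costs
    [O(|->| + p ^ 2)], as the number of blocks never exceeds [p]. *)

(** * Weakest preconditions with time and space bounds *)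

Arguments eval : simpl never.
Arguments set_reg : simpl never.
Arguments set_mem : simpl never.

(** * Frame conditions *)

Fixpoint written_vars (c : cmd) : seq var :=
  match c with
  | Assign x _ => [:: x]
  | Store _ _ _ | Skip => [::]
  | Seq c1 c2 | If _ c1 c2 => written_vars c1 ++ written_vars c2
  | While _ c1 => written_vars c1
  end.

Fixpoint written_arrs (c : cmd) : seq arr :=
  match c with
  | Store a _ _ => [:: a]
  | Assign _ _ | Skip => [::]
  | Seq c1 c2 | If _ c1 c2 => written_arrs c1 ++ written_arrs c2
  | While _ c1 => written_arrs c1
  end.

(** Membership is a Boolean [has], so that for a concrete command the frame conditions are settled
    by computation. *)
Definition agree (xs : seq var) (bs : seq arr) (st st' : state) :=
  (forall x, ~~ has (var_beq x) xs -> reg st' x = reg st x) /\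
  (forall a, ~~ has (arr_beq a) bs -> mem st' a = mem st a).

Definition framed (c : cmd) := agree (written_vars c) (written_arrs c).

Lemma agree_trans xs bs st1 st2 st3 :
  agree xs bs st1 st2 -> agree xs bs st2 st3 -> agree xs bs st1 st3.
Proof.
move=> [r12 m12] [r23 m23]; split=> [x|a] notin; first by rewrite r23 // r12.
by rewrite m23 // m12.
Qed.

Lemma agree_catl xs xs' bs bs' st st' :
  agree xs bs st st' -> agree (xs ++ xs') (bs ++ bs') st st'.
Proof.
by move=> [r m]; split=> [x|a]; rewrite has_cat negb_or => /andP[? ?]; auto.
Qed.

Lemma agree_catr xs xs' bs bs' st st' :
  agree xs' bs' st st' -> agree (xs ++ xs') (bs ++ bs') st st'.
Proof.
by move=> [r m]; split=> [x|a]; rewrite has_cat negb_or => /andP[? ?]; auto.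
Qed.

Lemma exec_framed inp c st st' t : exec inp c st st' t -> framed c st st'.
Proof.
elim=> {c st st' t} /=.
- move=> x e st; split=> [y|//] /=; rewrite orbF => /negbTE yx.
  by rewrite /set_reg /= yx.
- move=> a e1 e2 st; split=> [//|b] /=; rewrite orbF => /negbTE ba.
  by rewrite /set_mem /= ba.
- move=> c1 c2 st1 st2 st3 t1 t2 _ f1 _ f2.
  by apply: agree_trans (agree_catl _ _ f1) (agree_catr _ _ f2).
- move=> e c1 c2 st st' t _; case: ifP => _ f; first exact: agree_catl.
  exact: agree_catr.
- by [].
- by move=> e c st1 st2 st3 t1 t2 _ _ f1 _; apply: agree_trans.
- by [].
Qed.

(** * Reading and updating the memory *)

Definition rd (st : state) (a : arr) (i : nat) : nat := nth 0 (mem st a) i.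

Lemma rd_agree xs bs st st' a :
  agree xs bs st st' -> ~~ has (arr_beq a) bs -> rd st' a = rd st a.
Proof. by move=> [_ m] notin; rewrite /rd m. Qed.

Lemma reg_set_reg st x n y :
  reg (set_reg st x n) y = if var_beq y x then n else reg st y.
Proof. by []. Qed.

Lemma reg_set_mem st a i n y : reg (set_mem st a i n) y = reg st y.
Proof. by []. Qed.

Lemma rd_set_reg st x n a : rd (set_reg st x n) a = rd st a.
Proof. by []. Qed.

Lemma rd_set_mem st a i n b j :
  rd (set_mem st a i n) b j =
  if arr_beq b a && (j == i) then n else rd st b j.
Proof.
rewrite /rd /set_mem /=; case ba: (arr_beq b a) => //=.
by rewrite nth_set_nth /= (internal_arr_dec_bl ba).
Qed.

Section EvalEquations.
Variables (inp : input) (st : state).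

Lemma eval_num n : eval inp st (Num n) = n. Proof. by []. Qed.
Lemma eval_var x : eval inp st (Var x) = reg st x. Proof. by []. Qed.
Lemma eval_get a e : eval inp st (Get a e) = rd st a (eval inp st e).
Proof. by []. Qed.
Lemma eval_add e1 e2 :
  eval inp st (Add e1 e2) = eval inp st e1 + eval inp st e2.
Proof. by []. Qed.
Lemma eval_mul e1 e2 :
  eval inp st (Mul e1 e2) = eval inp st e1 * eval inp st e2.
Proof. by []. Qed.
Lemma eval_lt e1 e2 :
  eval inp st (Lt e1 e2) = (eval inp st e1 < eval inp st e2).
Proof. by []. Qed.
Lemma eval_eq e1 e2 :
  eval inp st (Eq e1 e2) = (eval inp st e1 == eval inp st e2).
Proof. by []. Qed.
Lemma eval_and e1 e2 :
  eval inp st (And e1 e2) = (eval inp st e1 != 0) && (eval inp st e2 != 0).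
Proof. by []. Qed.
Lemma eval_not e : eval inp st (Not e) = (eval inp st e == 0).
Proof. by []. Qed.
Lemma eval_nstates : eval inp st NStates = nstates inp. Proof. by []. Qed.
Lemma eval_nedges : eval inp st NEdges = size (edges inp). Proof. by []. Qed.
Lemma eval_src e :
  eval inp st (Src e) = (nth (0, 0) (edges inp) (eval inp st e)).1.
Proof. by []. Qed.
Lemma eval_dst e :
  eval inp st (Dst e) = (nth (0, 0) (edges inp) (eval inp st e)).2.
Proof. by []. Qed.
Lemma eval_label_sub e1 e2 :
  eval inp st (LabelSub e1 e2) =
  label_sub inp (eval inp st e1) (eval inp st e2).
Proof. by []. Qed.

End EvalEquations.

Definition evalE := (eval_num, eval_var, eval_get, eval_add, eval_mul, eval_lt,
  eval_eq, eval_and, eval_not, eval_nstates, eval_nedges, eval_src, eval_dst,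
  eval_label_sub).
Definition updE := (reg_set_reg, reg_set_mem, rd_set_reg, rd_set_mem).
Definition boolE := (eqb0, negbK).

(** * Rules for total correctness with resource bounds *)

Section WeakestPrecondition.

(* [cap a] bounds the size of the array [a], and [iters e] the number of
   iterations of the loops guarded by [e]; the cost of a command is then a
   function of its syntax. *)
Variables (inp : input) (cap : arr -> nat) (iters : expr -> nat).

Fixpoint cost (c : cmd) : nat :=
  match c with
  | Assign _ e => (ecost e).+1
  | Store _ e1 e2 => (ecost e1 + ecost e2).+1
  | Seq c1 c2 => cost c1 + cost c2
  | If e c1 c2 => (ecost e + maxn (cost c1) (cost c2)).+1
  | While e c1 => (iters e).+1 * (ecost e + cost c1).+1
  | Skip => 1
  end.

Definition within (st : state) := forall a, size (mem st a) <= cap a.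

(** Total correctness: a halting run is exhibited. Time is compared with the syntactic [cost], so
    postconditions need no clock. The space bound is stated as preservation of [within], which
    composes along sequences and is discharged once, from the empty initial memory. *)
Definition wp (c : cmd) (st : state) (Q : state -> Prop) : Prop :=
  exists st' t, [/\ exec inp c st st' t, t <= cost c,
    within st -> within st' & Q st'].

Lemma wp_weaken c st (Q Q' : state -> Prop) :
  wp c st Q -> (forall st', framed c st st' -> Q st' -> Q' st') -> wp c st Q'.
Proof.
move=> [st' [t [ex tle wi q]]] QQ'; exists st', t; split=> //.
by apply: QQ' => //; apply: exec_framed ex.
Qed.

Lemma wp_skip st (Q : state -> Prop) : Q st -> wp Skip st Q.
Proof. by move=> q; exists st, 1; split=> //; constructor. Qed.

Lemma wp_assign x e st (Q : state -> Prop) :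
  Q (set_reg st x (eval inp st e)) -> wp (Assign x e) st Q.
Proof.
move=> q; exists (set_reg st x (eval inp st e)), (ecost e).+1.
by split=> //; constructor.
Qed.

Lemma wp_store a e1 e2 st (Q : state -> Prop) :
  eval inp st e1 < cap a ->
  Q (set_mem st a (eval inp st e1) (eval inp st e2)) ->
  wp (Store a e1 e2) st Q.
Proof.
move=> lt_cap q.
exists (set_mem st a (eval inp st e1) (eval inp st e2)),
  (ecost e1 + ecost e2).+1.
split=> //; first exact: ExecStore.
move=> wi b; rewrite /set_mem /=; case: ifP => // /internal_arr_dec_bl ->.
by rewrite size_set_nth geq_max lt_cap wi.
Qed.

Lemma wp_seq c1 c2 st (Q1 Q : state -> Prop) :
  wp c1 st Q1 -> (forall st1, framed c1 st st1 -> Q1 st1 -> wp c2 st1 Q) ->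
  wp (Seq c1 c2) st Q.
Proof.
move=> [st1 [t1 [ex1 t1le wi1 q1]]] /(_ st1 (exec_framed ex1) q1).
move=> [st2 [t2 [ex2 t2le wi2 q2]]]; exists st2, (t1 + t2); split=> //.
- exact: ExecSeq ex1 ex2.
- exact: leq_add.
- by move/wi1/wi2.
Qed.

Lemma wp_assign_seq x e c st (Q : state -> Prop) :
  wp c (set_reg st x (eval inp st e)) Q -> wp (Seq (Assign x e) c) st Q.
Proof.
move=> h; apply: (@wp_seq _ _ _ (fun s => s = set_reg st x (eval inp st e))).
  exact: wp_assign.
by move=> _ _ ->.
Qed.

Lemma wp_store_seq a e1 e2 c st (Q : state -> Prop) :
  eval inp st e1 < cap a ->
  wp c (set_mem st a (eval inp st e1) (eval inp st e2)) Q ->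
  wp (Seq (Store a e1 e2) c) st Q.
Proof.
move=> lt_cap h.
apply: (@wp_seq _ _ _
  (fun s => s = set_mem st a (eval inp st e1) (eval inp st e2))).
  exact: wp_store.
by move=> _ _ ->.
Qed.

Lemma wp_if e c1 c2 st (Q : state -> Prop) :
  (eval inp st e != 0 -> wp c1 st Q) -> (eval inp st e = 0 -> wp c2 st Q) ->
  wp (If e c1 c2) st Q.
Proof.
move=> wp1 wp2; have [e0|e1] := eqVneq (eval inp st e) 0.
  have [st' [t [ex tle wi q]]] := wp2 e0; exists st', (ecost e + t).+1;
    split=> //.
    by apply: ExecIf; rewrite e0.
  by rewrite /= ltnS leq_add2l leq_max tle orbT.
have [st' [t [ex tle wi q]]] := wp1 e1; exists st', (ecost e + t).+1;
  split=> //.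
  by apply: ExecIf; rewrite e1.
by rewrite /= ltnS leq_add2l leq_max tle.
Qed.

(** The variant [mu] gives termination and the iteration count at once; only its initial value is
    compared with [iters e]. *)
Lemma wp_while e c (I : state -> Prop) (mu : state -> nat) st :
  I st -> mu st <= iters e ->
  (forall st1, I st1 -> eval inp st1 e != 0 ->
     wp c st1 (fun st2 => I st2 /\ mu st2 < mu st1)) ->
  wp (While e c) st (fun st' => I st' /\ eval inp st' e = 0).
Proof.
move=> ist mule step.
(* Induction on a bound [m] of the variant; the factor [m.+1] also pays for the last, failing test
   of the guard. *)
suff loop m st1 : mu st1 <= m -> I st1 ->
    exists st' t, [/\ exec inp (While e c) st1 st' t,
      t <= m.+1 * (ecost e + cost c).+1, within st1 -> within st'
      & I st' /\ eval inp st' e = 0].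
  have [st' [t [ex tle wi q]]] := loop _ _ (leqnn (mu st)) ist.
  exists st', t; split=> //; apply: leq_trans tle _.
  by rewrite leq_mul2r orbC ltnS mule.
elim: m st1 => [|m IH] st1 mu1 ist1;
  have [e0|e0] := eqVneq (eval inp st1 e) 0.
- exists st1, (ecost e).+1; split=> //; first exact: ExecWhileStop.
  by lia.
(* With the variant at 0 the guard cannot hold, since the body would have to decrease it. *)
- have [st2 [t [_ _ _ [_]]]] := step _ ist1 e0.
  by move: mu1; rewrite leqn0 => /eqP ->.
- exists st1, (ecost e).+1; split=> //; first exact: ExecWhileStop.
  by rewrite mulSn; lia.
- have [st2 [t2 [ex2 t2le wi2 [ist2 mu2]]]] := step _ ist1 e0.
  have [|st3 [t3 [ex3 t3le wi3 q3]]] := IH st2 _ ist2.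
    by rewrite -ltnS (leq_trans mu2 mu1).
  exists st3, (ecost e + t2 + t3).+1; split=> //.
  + exact: ExecWhileLoop ex2 ex3.
  + by rewrite mulSn; lia.
  + by move/wi2/wi3.
Qed.

(** The frame [within_loop] is carried along automatically, so an invariant [I] has to mention only
    what the body modifies. The invariant is required after the increment of the counter, whence
    [set_reg] in the postcondition of the body. *)
Lemma wp_for x b c n (I : nat -> state -> Prop) st (Q : state -> Prop) :
  let within_loop := agree (x :: written_vars c) (written_arrs c) st in
  ~~ has (var_beq x) (written_vars c) ->
  n <= iters (Lt (Var x) b) ->
  (forall st', within_loop st' -> eval inp st' b = n) ->
  I 0 (set_reg st x 0) ->
  (forall i st', i < n -> reg st' x = i -> within_loop st' -> I i st' ->
     wp c st' (fun st2 => I i.+1 (set_reg st2 x i.+1))) ->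
  (forall st', within_loop st' -> I n st' -> Q st') ->
  wp (For x b c) st Q.
Proof.
move=> within_loop xc nle bn I0 step IQ; apply: wp_assign_seq; rewrite evalE.
have xx : var_beq x x by apply: internal_var_dec_lb.
have loop0 : within_loop (set_reg st x 0).
  split=> [y|//]; rewrite /= negb_or => /andP[/negbTE yx _].
  by rewrite yx.
have /wp_weaken : wp (While (Lt (Var x) b) (Seq c (Assign x (Add (Var x)
  (Num 1)))))
    (set_reg st x 0) (fun st' =>
      (exists2 i, i <= n & [/\ reg st' x = i, within_loop st' & I i st'])
      /\ eval inp st' (Lt (Var x) b) = 0).
  apply: (@wp_while _ _ _ (fun st' => n - reg st' x)).
  - by exists 0 => //; split=> //; rewrite reg_set_reg xx.
  - by rewrite /= xx subn0.
  move=> st1 [i ilen [xi loop1 Ii]]; rewrite !evalE bn // xi.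
  case: ltnP => // iltn _.
  apply: wp_seq (step _ _ iltn xi loop1 Ii) _ => st2 fr2 Ii2.
  apply: wp_assign; rewrite !evalE.
  have x2 : reg st2 x = i by rewrite (proj1 fr2).
  rewrite reg_set_reg xx x2 addn1; split; last by lia.
  exists i.+1 => //; split=> //.
  apply: agree_trans loop1 _; split=> [y|a na].
    rewrite /= negb_or => /andP[/negbTE yx yc].
    by rewrite yx (proj1 fr2).
  by rewrite -(proj2 fr2).
apply=> st' _ [[i ilen [xi loop' Ii]]].
rewrite !evalE bn // xi => /eqP; rewrite eqb0 -leqNgt => nlei.
by apply: IQ => //; have -> : n = i by lia.
Qed.

Lemma wp_for_inv x b c n (I : nat -> state -> Prop) st :
  let within_loop := agree (x :: written_vars c) (written_arrs c) st in
  ~~ has (var_beq x) (written_vars c) ->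
  n <= iters (Lt (Var x) b) ->
  (forall st', within_loop st' -> eval inp st' b = n) ->
  I 0 (set_reg st x 0) ->
  (forall i st', i < n -> reg st' x = i -> within_loop st' -> I i st' ->
     wp c st' (fun st2 => I i.+1 (set_reg st2 x i.+1))) ->
  wp (For x b c) st (I n).
Proof. by move=> wl xc nle bn I0 step; apply: (@wp_for x b c n I). Qed.

End WeakestPrecondition.

(** * The program *)

(** Here [p] bounds the number of blocks at all times. Two arrays are indexed by states, two hold an
    order matrix, and all the others are indexed by blocks or by positions in the list. *)
Definition capacity (n p : nat) (a : arr) : nat :=
  match a with
  | aBlk | aPre => n
  | aRel | aRel' => p * p
  | _ => p
  end.

(** Each loop is recognised by the shape of its guard. The guard on [vPos] is that of the scan,
    whose bound [p * p + p] is the largest possible initial weight. *)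
Definition iterations (n e p : nat) (guard : expr) : nat :=
  match guard with
  | Lt _ NStates => n
  | Lt _ NEdges => e
  | Lt _ (Mul _ _) => p * p
  | Lt (Var vPos) _ => p * p + p
  | _ => p
  end.

Lemma ltnS_eqVlt k i : k < i.+1 -> k = i \/ k < i.
Proof. lia. Qed.

(** Row-major indexing is injective by uniqueness of Euclidean division. *)
Lemma eq_pair_index m i j k l : j < m -> l < m ->
  (i * m + j == k * m + l) = (i == k) && (j == l).
Proof.
move=> jm lm; apply/eqP/andP => [eq_ij|[/eqP-> /eqP-> //]].
have := congr1 (edivn^~ m) eq_ij.
by rewrite !edivn_eq // => -[-> ->]; rewrite !eqxx.
Qed.

Lemma pair_index_lt m i j p : i < m -> j < m -> m <= p -> i * m + j < p * p.
Proof. nia. Qed.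

Section Program.
Variables (inp : input) (p : nat).
Let n := nstates inp.
Let es := edges inp.
Let wp c st Q :=
  wp inp (capacity n p) (iterations n (size es) p) c st Q.

(** * The image of the current block and its predecessors *)

Lemma wp_compute_image m st :
  reg st vNum = m -> m <= p ->
  wp compute_image st (fun st' =>
    forall i, i < m -> rd st' aImg i = rd st aRel (i * m + reg st vCur)).
Proof.
move=> num_m mp; apply: (@wp_for _ _ _ _ _ _ m (fun k st' =>
  forall i, i < k -> rd st' aImg i = rd st aRel (i * m + reg st vCur))) => //.
- by move=> st' [r _]; rewrite evalE r.
move=> i st1 im ri ag I1; apply: wp_store; rewrite !evalE ri /=.
  exact: leq_trans mp.
move=> k /ltnS_eqVlt ki; rewrite !updE /=.
have [->|/negbTE ne] := eqVneq k i.
  by rewrite !(proj1 ag) // num_m (rd_agree ag).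
by apply: I1; lia.
Qed.

Lemma wp_compute_pre st :
  (forall e, e \in es -> e.1 < n) ->
  wp compute_pre st (fun st' => forall s, s < n ->
    (rd st' aPre s != 0) =
    has (fun e => (e.1 == s) && (rd st aImg (rd st aBlk e.2) != 0)) es).
Proof.
move=> src_lt; apply: wp_seq.
  apply: (@wp_for_inv _ _ _ _ _ _ n (fun k st' =>
    forall s, s < k -> rd st' aPre s = 0)) => //.
  move=> i st1 lin ri ag I1; apply: wp_store; rewrite !evalE ri //.
  move=> k /ltnS_eqVlt ki; rewrite !updE /=.
  by have [//|/negbTE ne] := eqVneq k i; apply: I1; lia.
(* After [k] rounds the marked states are the sources of those among the first [k] transitions that
   enter the image. *)
move=> st1 fr1 pre0; apply: (@wp_for _ _ _ _ _ _ (size es) (fun k st' =>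
  forall s, s < n -> (rd st' aPre s != 0) =
    has (fun e => (e.1 == s) && (rd st aImg (rd st aBlk e.2) != 0))
      (take k es))) => //.
- by move=> s sn; rewrite !updE take0 pre0.
- move=> i st2 lin ri ag I2.
  have step s : has (fun e => (e.1 == s) && (rd st aImg (rd st aBlk e.2) != 0))
      (take i.+1 es) =
    ((nth (0, 0) es i).1 == s) &&
      (rd st aImg (rd st aBlk (nth (0, 0) es i).2) != 0) ||
    has (fun e => (e.1 == s) && (rd st aImg (rd st aBlk e.2) != 0))
      (take i es).
    by rewrite (take_nth (0, 0)) // has_rcons.
  apply: wp_if; rewrite !evalE ri !(rd_agree ag) // !(rd_agree fr1) //.
    move=> img; apply: wp_store; rewrite !evalE ri.
      by apply: src_lt; apply: mem_nth.
    move=> s sn; rewrite !updE /= step img andbT (eq_sym _ s).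
    by case: (s == _) => //; apply: I2.
  move=> img; apply: wp_skip => s sn; rewrite !updE step.
  by rewrite -[edges inp]/es in img; rewrite img andbF; apply: I2.
- by move=> st2 ag I2 s sn; rewrite I2 // take_size.
Qed.

(** * Numbering of the blocks after a split *)

Section Split.
Variables (blk : nat -> nat) (pre : nat -> bool) (m : nat).

Definition meets (b : nat) :=
  has (fun s => (blk s == b) && pre s) (iota 0 n).
Definition differs (b : nat) :=
  has (fun s => (blk s == b) && ~~ pre s) (iota 0 n).
Definition splits (b : nat) := meets b && differs b.
(** The value of [vNum'] when the loop reaches block [b]: the number given to the inner part of [b]
    if [b] splits. Hence [fresh m] is the number of blocks after the split. *)
Definition fresh (b : nat) := m + count splits (iota 0 b).

Lemma freshS b : fresh b.+1 = fresh b + splits b.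
Proof. by rewrite /fresh -addn1 iotaD count_cat addnA /= addn0. Qed.

Lemma fresh_le b c : b <= c -> fresh b <= fresh c.
Proof. by move=> /subnKC <-; rewrite /fresh iotaD count_cat addnA leq_addr. Qed.

Lemma fresh_lt b c : splits b -> b < c -> fresh b < fresh c.
Proof. by move=> sb /fresh_le; rewrite freshS sb addn1. Qed.

(** The function [fresh] increases strictly just after each splitting block. *)
Lemma fresh_inj b c :
  splits b -> splits c -> (fresh b == fresh c) = (b == c).
Proof.
move=> sb sc; case: (ltngtP b c) => [lt|lt|->]; last by rewrite eqxx.
- by have := fresh_lt sb lt; case: ltngtP.
- by have := fresh_lt sc lt; case: ltngtP.
Qed.

Lemma fresh_ge b : m <= fresh b. Proof. exact: leq_addr. Qed.

End Split.

(** The old numbering is passed as a function [blk], because [aBlk] is overwritten. The hypothesis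
    [fr m <= p] keeps the entries of the fresh blocks within capacity. *)
Lemma wp_split m (blk : nat -> nat) (pre : nat -> bool) st :
  let fr := fresh blk pre m in let sp := splits blk pre in
  reg st vNum = m -> m <= p -> fr m <= p ->
  (forall s, s < n -> rd st aBlk s = blk s) ->
  (forall s, s < n -> blk s < m) ->
  (forall s, s < n -> (rd st aPre s != 0) = pre s) ->
  wp split st (fun st' =>
    [/\ reg st' vNum' = fr m,
        forall s, s < n -> rd st' aBlk s =
          if pre s && sp (blk s) then fr (blk s) else blk s,
        forall b, b < m -> rd st' aPar b = b /\
          rd st' aInPre b = meets blk pre b && ~~ differs blk pre b &
        forall b, b < m -> sp b ->
          rd st' aPar (fr b) = b /\ rd st' aInPre (fr b) = 1]).
Proof.
move=> fr sp num_m mp freshp blkE blk_lt preE.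
apply: wp_seq.
  apply: (@wp_for_inv _ _ _ _ _ _ m (fun k st' => forall b, b < k ->
    rd st' aMeet b = 0 /\ rd st' aDiff b = 0)) => //.
    by move=> st' [r _]; rewrite evalE r.
  move=> i st1 lin ri ag I1.
  apply: wp_store_seq; rewrite ?evalE ?ri; first exact: leq_trans mp.
  apply: wp_store; rewrite ?evalE ?updE ?ri; first exact: leq_trans mp.
  move=> k /ltnS_eqVlt ki; rewrite ?updE /=.
  by have [//|/negbTE ne] := eqVneq k i; apply: I1; lia.
move=> st1 fr1 zero; apply: wp_seq.
  apply: (@wp_for_inv _ _ _ _ _ _ n (fun k st' => forall b, b < m ->
    (rd st' aMeet b != 0) = has (fun s => (blk s == b) && pre s) (iota 0 k)
    /\ (rd st' aDiff b != 0) =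
         has (fun s => (blk s == b) && ~~ pre s) (iota 0 k))) => //.
    by move=> b bm; rewrite ?updE /=; have [-> ->] := zero b bm.
  move=> i st2 lin ri ag I2; have step q : has q (iota 0 i.+1) =
      has q (iota 0 i) || q i.
    by rewrite -addn1 iotaD has_cat /= orbF.
  have blk2 : rd st2 aBlk i = blk i.
    by rewrite (rd_agree ag) // (rd_agree fr1) // blkE.
  have pre2 : (rd st2 aPre i != 0) = pre i.
    by rewrite (rd_agree ag) // (rd_agree fr1) // preE.
  apply: wp_if; rewrite ?evalE ?ri => pi; apply: wp_store;
    rewrite ?evalE ?ri blk2 ?(leq_trans (blk_lt _ lin)) // => b bm;
    rewrite ?updE !step /= -pre2 pi /= ?andbF ?andbT ?orbF (eq_sym _ b);
    have [mE dE] := I2 b bm; split; rewrite -?mE -?dE;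
    by case: (b == blk i); rewrite ?orbT ?orbF.
move=> st2 fr2 I2.
have {I2} [meetE diffE] : (forall b, b < m ->
    (rd st2 aMeet b != 0) = meets blk pre b) /\ (forall b, b < m ->
    (rd st2 aDiff b != 0) = differs blk pre b).
  by split=> b /I2 [].
have num2 : reg st2 vNum = m by rewrite (proj1 fr2) // (proj1 fr1).
apply: wp_assign_seq; rewrite evalE num2; apply: wp_seq.
  apply: (@wp_for_inv _ _ _ _ _ _ m (fun k st' =>
    [/\ reg st' vNum' = fr k,
        forall b, b < k ->
          [/\ rd st' aPar b = b, rd st' aNew b = if sp b then fr b else b
            & rd st' aInPre b = meets blk pre b && ~~ differs blk pre b] &
        forall b, b < k -> sp b ->
          rd st' aPar (fr b) = b /\ rd st' aInPre (fr b) = 1])) => //.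
  - by move=> st' [r _]; rewrite evalE r.
  - by split=> //; rewrite /fr /fresh addn0.
  move=> i st3 lin ri ag [num3 old3 new3].
  have ip : i < p by apply: leq_trans mp.
  apply: wp_store_seq; rewrite ?evalE ?ri //.
  apply: wp_store_seq; rewrite ?evalE ?updE ?ri //.
  apply: wp_store_seq; rewrite ?evalE ?updE ?ri //=.
  rewrite !boolE !(rd_agree ag) // ?updE meetE // -[rd st2 aDiff i == 0]negbK.
  rewrite diffE //.
  (* Fresh numbers are at least [m], so writes at fresh and at old indices do not interfere. *)
  have fresh_i b : b < m -> sp b -> (fr b == i) = false.
    by move=> *; apply/negbTE; have := fresh_ge blk pre m b; rewrite -/fr; lia.
  have i_fresh b c : b < m -> sp b -> c <= i -> (c == fr b) = false.
    by move=> *; apply/negbTE; have := fresh_ge blk pre m b; rewrite -/fr; lia.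
  apply: wp_if; rewrite ?evalE ?updE /= ?ri !(rd_agree ag) // ?updE
     meetE // diffE // -/(sp i) => spl.
    have {}spl : sp i by move: spl; rewrite /sp /splits; case: (_ && _).
    apply: wp_store_seq; rewrite ?evalE ?updE ?ri //.
    have fp : fr i < p by apply: leq_trans freshp; apply: fresh_lt.
    apply: wp_store_seq; rewrite ?evalE ?updE num3 //.
    apply: wp_store_seq; rewrite ?evalE ?updE num3 //.
    apply: wp_assign; rewrite ?evalE ?updE /= num3; split.
    + by rewrite ?updE /= /fr freshS -/sp spl.
    + move=> b /ltnS_eqVlt bi; rewrite ?updE /= ?ri i_fresh //; last by lia.
      have [->|/negbTE ne] := eqVneq b i; first by rewrite spl.
      by apply: old3; lia.
    + move=> b /ltnS_eqVlt bi sb; rewrite ?updE /= ?ri.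
      rewrite fresh_inj // fresh_i //; last by lia.
      have [->//|/negbTE ne] := eqVneq b i.
      by apply: new3 => //; lia.
  apply: wp_skip; have {}spl : sp i = false.
    by move: spl; rewrite /sp /splits; case: (_ && _).
  split.
  + by rewrite ?updE /= num3 /fr freshS -/sp spl addn0.
  + move=> b /ltnS_eqVlt bi; rewrite ?updE /= ?ri.
    have [->|/negbTE ne] := eqVneq b i; first by rewrite spl.
    by apply: old3; lia.
  + move=> b /ltnS_eqVlt bi sb; rewrite ?updE /= ?ri fresh_i //; last by lia.
    have [bi'|/negbTE ne] := eqVneq b i; first by rewrite bi' spl in sb.
    by apply: new3 => //; lia.
move=> st3 fr3 [num3 old3 new3].
(* The renumbering is done in place: states below [k] carry their new number, the others still their
   old one. *)
apply: (@wp_for _ _ _ _ _ _ n (fun k st' =>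
  (forall s, s < k -> rd st' aBlk s =
    if pre s && sp (blk s) then fr (blk s) else blk s) /\
  (forall s, k <= s < n -> rd st' aBlk s = blk s))) => //.
- split=> // s sn; rewrite ?updE (rd_agree fr3) //.
  by rewrite ?updE (rd_agree fr2) // (rd_agree fr1) // blkE.
- move=> i st4 lin ri ag [done4 todo4].
  have blk4 : rd st4 aBlk i = blk i by apply: todo4; rewrite leqnn.
  have pre4 : (rd st4 aPre i != 0) = pre i.
    rewrite (rd_agree ag) // (rd_agree fr3) // ?updE.
    by rewrite (rd_agree fr2) // (rd_agree fr1) // preE.
  apply: wp_if; rewrite ?evalE ?ri => pi; [apply: wp_store|apply: wp_skip];
    rewrite ?evalE ?ri ?blk4 //; split=> s.
  + move/ltnS_eqVlt => si; rewrite ?updE /=.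
    have [->|/negbTE ne] := eqVneq s i; last by apply: done4; lia.
    rewrite (rd_agree ag) // -pre4 pi /=.
    by have [_ -> _] := old3 _ (blk_lt _ lin).
  + move=> /andP[il sn]; rewrite ?updE /=.
    have /negbTE -> : s != i by lia.
    by apply: todo4; rewrite ltnW.
  + move/ltnS_eqVlt => si; rewrite ?updE.
    have [->|/negbTE ne] := eqVneq s i; last by apply: done4; lia.
    by rewrite -pre4 pi /= blk4.
  + by move=> /andP[il sn]; rewrite ?updE; apply: todo4; rewrite ltnW.
move=> st4 ag [done4 _]; split=> //.
- by rewrite (proj1 ag).
- by move=> b bm; rewrite !(rd_agree ag) //; have [-> _ ->] := old3 b bm.
- by move=> b bm sb; rewrite !(rd_agree ag) //; apply: new3.
Qed.

(** Here [old i j] is the order between the parents, and [lost i j] says that block [i] leaves the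
    image of block [j] because [j] lies in pre(X) and [i] does not. A block is marked as changed
    when its column has a lost entry. *)
Lemma wp_update_order m m' st :
  reg st vNum = m -> reg st vNum' = m' -> m' <= p ->
  let old i j := rd st aRel (rd st aPar i * m + rd st aPar j) in
  let lost i j :=
    [&& old i j != 0, rd st aInPre j != 0 & rd st aInPre i == 0] in
  wp update_order st (fun st' =>
    (forall i j, i < m' -> j < m' ->
       rd st' aRel (i * m' + j) = if lost i j then 0 else old i j) /\
    (forall j, j < m' ->
       (rd st' aChg j != 0) = has (lost^~ j) (iota 0 m'))).
Proof.
move=> numE num'E m'p old lost; apply: wp_seq.
  apply: (@wp_for_inv _ _ _ _ _ _ m' (fun k st' =>
    (forall i j, i < m' -> j < k ->
      rd st' aRel' (i * m' + j) = if lost i j then 0 else old i j) /\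
    (forall j, j < k -> (rd st' aChg j != 0) = has (lost^~ j) (iota 0 m'))))
    => //.
    by move=> st' [r _]; rewrite evalE r.
  move=> j st1 lin rj ag [rel1 chg1].
  apply: wp_store_seq; rewrite ?evalE rj; first exact: leq_trans m'p.
  (* The columns before [j] are complete, and column [j] with its mark is complete up to row [k]. *)
  apply: (@wp_for _ _ _ _ _ _ m' (fun k st' =>
    [/\ forall i l, i < m' -> l < j ->
          rd st' aRel' (i * m' + l) = if lost i l then 0 else old i l,
        forall i, i < k ->
          rd st' aRel' (i * m' + j) = if lost i j then 0 else old i j,
        forall l, l < j -> (rd st' aChg l != 0) = has (lost^~ l) (iota 0 m') &
        (rd st' aChg j != 0) = has (lost^~ j) (iota 0 k)])) => //.
  - by move=> st' [r _]; rewrite evalE r // reg_set_mem (proj1 ag).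
  - split=> // [l lj|]; rewrite ?updE /= ?eqxx //.
    by rewrite (ltn_eqF lj); apply: chg1.
  - move=> i st2 lin2 ri ag2 [rel2 row2 chg2 col2].
    have step : has (lost^~ j) (iota 0 i.+1) =
        has (lost^~ j) (iota 0 i) || lost i j.
      by rewrite -addn1 iotaD has_cat /= orbF.
    have [rj2 num2 num'2] :
        [/\ reg st2 vJ = j, reg st2 vNum = m & reg st2 vNum' = m'].
      by rewrite !(proj1 ag2) // !reg_set_mem rj !(proj1 ag).
    have same a : ~~ has (arr_beq a) [:: aChg; aRel'] -> rd st2 a = rd st a.
      by case: a => // _; rewrite (rd_agree ag2) // -(rd_agree ag).
    have rel_lt : i * m' + j < p * p by apply: pair_index_lt m'p.
    apply: wp_assign_seq; rewrite ?evalE ri rj2 num2 !same // -/(old i j).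
    (* Between the test and the store, the mark already accounts for row [i] but the matrix does
       not. *)
    apply: (@wp_seq _ _ _ _ _ _ (fun st' =>
      reg st' vVal = (if lost i j then 0 else old i j) /\
      [/\ forall i l, i < m' -> l < j ->
          rd st' aRel' (i * m' + l) = if lost i l then 0 else old i l,
        forall k, k < i ->
          rd st' aRel' (k * m' + j) = if lost k j then 0 else old k j,
        forall l, l < j -> (rd st' aChg l != 0) = has (lost^~ l) (iota 0 m') &
        (rd st' aChg j != 0) = has (lost^~ j) (iota 0 i.+1)])).
      apply: wp_if; rewrite ?evalE ?updE /= ri rj2 !same // -/(lost i j);
        rewrite ?boolE => lo.
        have {}lo : lost i j by move: lo; rewrite /lost; case: (_ && _).
        apply: wp_assign_seq; rewrite evalE; apply: wp_store;
          rewrite ?evalE ?updE /=.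
          by rewrite rj2; apply: leq_trans m'p.
        rewrite rj2; split; first by rewrite lo.
        split=> //.
        + by move=> l lj; rewrite ?updE /= (ltn_eqF lj); apply: chg2.
        + by rewrite -[_ || _]/(has (lost^~ j)
            (iota 0 i.+1)) step lo orbT ?updE /= eqxx.
      have {}lo : lost i j = false by move: lo; rewrite /lost; case: (_ && _).
      apply: wp_skip; rewrite lo; split=> //; split=> //.
      by rewrite -[_ || _]/(has (lost^~ j) (iota 0 i.+1)) step lo orbF ?updE.
    move=> st3 fr3 [val3 [rel3 row3 chg3 col3]].
    have [ri3 rj3 num'3] : [/\ reg st3 vI = i,
      reg st3 vJ = j & reg st3 vNum' = m'].
      by rewrite !(proj1 fr3).
    apply: wp_store; rewrite ?evalE ri3 rj3 num'3 ?val3 //; split.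
    + move=> k l km lj; rewrite ?updE /= eq_pair_index //;
        last exact: ltn_trans lin.
      by rewrite (ltn_eqF lj) andbF; apply: rel3.
    + move=> k /ltnS_eqVlt ki; rewrite ?updE /= eq_pair_index // eqxx andbT.
      have [->//|/negbTE ne] := eqVneq k i.
      by apply: row3; lia.
    + by move=> l lj; rewrite ?updE /=; apply: chg3.
    + by rewrite ?updE /=.
  - move=> st2 ag2 [rel2 row2 chg2 col2]; split.
    + move=> i l im /ltnS_eqVlt lj; rewrite ?updE.
      have [->|/negbTE ne] := eqVneq l j; first exact: row2.
      by apply: rel2; lia.
    + move=> l /ltnS_eqVlt lj; rewrite ?updE.
      have [->|/negbTE ne] := eqVneq l j; first exact: col2.
      by apply: chg2; lia.
move=> st1 fr1 [rel1 chg1].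
(* The row length changes from [m] to [m'], so the new matrix was built aside and is copied back
   only after the last read of the old one. *)
apply: (@wp_for _ _ _ _ _ _ (m' * m') (fun k st' =>
  forall i, i < k -> rd st' aRel i = rd st1 aRel' i)) => //.
- by rewrite /= leq_mul.
- by move=> st' ag; rewrite ?evalE !(proj1 ag) // !(proj1 fr1) // num'E.
- move=> i st2 lin ri ag I2; apply: wp_store; rewrite ?evalE ri.
    by apply: leq_trans lin _; rewrite /= leq_mul.
  move=> k /ltnS_eqVlt ki; rewrite ?updE /= (rd_agree ag) //.
  by have [->//|/negbTE ne] := eqVneq k i; apply: I2; lia.
- move=> st2 ag I2; split=> [i j im jm|j jm].
    by rewrite I2 ?rel1 //; apply: pair_index_lt.
  by rewrite (rd_agree ag) // chg1.
Qed.

(** * Updating the list of blocks *)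

Lemma mkseq_rcons (f g : nat -> nat) l v s :
  (forall i, f i = if i == l then v else g i) -> mkseq g l = s ->
  mkseq f l.+1 = rcons s v.
Proof.
move=> fE <-; rewrite mkseqS [f l]fE eqxx; congr rcons.
apply/eq_in_map => i; rewrite mem_iota add0n => /andP[_ il].
by rewrite fE (ltn_eqF il).
Qed.

(** The size hypothesis says that kept and changed blocks together fill the new list exactly; it
    keeps the stores in bounds and gives the final value of [vLen]. The new position counts the kept
    blocks among the first [pos + 1] entries, the block just scanned included. *)
Lemma wp_update_list m m' st :
  let lst := mkseq (rd st aLst) m in
  let chg b := rd st aChg b != 0 in
  let kept := filter (predC chg) lst in
  reg st vNum = m -> reg st vNum' = m' -> m <= m' -> m' <= p ->
  size kept + count chg (iota 0 m') = m' ->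
  wp update_list st (fun st' =>
    [/\ reg st' vNum = m',
        reg st' vPos = count (predC chg) (take (reg st vPos).+1 lst) &
        mkseq (rd st' aLst) m' = kept ++ filter chg (iota 0 m')]).
Proof.
move=> lst chg kept numE num'E mm' m'p sizeE.
set pos := reg st vPos.
have lst_take k : k <= m -> take k lst = mkseq (rd st aLst) k.
  by move=> km; rewrite /lst /mkseq -map_take take_iota (minn_idPl km).
apply: wp_assign_seq; apply: wp_assign_seq; rewrite ?evalE.
apply: wp_seq.
  apply: (@wp_for_inv _ _ _ _ _ _ m (fun k st' =>
    [/\ reg st' vLen = size (filter (predC chg) (mkseq (rd st aLst) k)),
        reg st' vPos' = count (predC chg) (take (minn pos.+1 k) lst) &
        mkseq (rd st' aLst') (reg st' vLen) =
          filter (predC chg) (mkseq (rd st aLst) k)])) => //.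
  - exact: leq_trans mm' m'p.
  - by move=> st' [r _]; rewrite evalE r.
  - by split; rewrite /= ?minn0 ?take0.
  move=> i st1 lin ri ag [len1 pos1 lst1].
  have rd1 a : ~~ has (arr_beq a) [:: aLst'] -> rd st1 a = rd st a.
    by move=> na; rewrite (rd_agree ag).
  have reg1 : reg st1 vPos = pos by rewrite (proj1 ag).
  have posS : count (predC chg) (take (minn pos.+1 i.+1) lst) =
      count (predC chg) (take (minn pos.+1 i) lst) +
      (i < pos.+1) && ~~ chg (rd st aLst i).
    have [ip|pi] := ltnP i pos.+1.
      rewrite (minn_idPr ip) !lst_take // 1?ltnW //.
      by rewrite mkseqS -cats1 count_cat /= addn0.
    by rewrite (minn_idPl (leqW pi)) addn0.
  apply: wp_if; rewrite ?evalE ri !rd1 // -/(chg (rd st aLst i)) => ch.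
    apply: wp_skip; rewrite mkseqS filter_rcons posS ch andbF addn0.
    by have -> : predC chg (rd st aLst i) = false by rewrite /= ch.
  have {}ch : chg (rd st aLst i) = false by rewrite /chg ch.
  apply: wp_store_seq; rewrite ?evalE.
    rewrite len1 size_filter /=.
    apply: leq_trans m'p; apply: leq_trans mm'.
    apply: leq_ltn_trans (count_size _ _) _; by rewrite size_mkseq.
  rewrite ri rd1 //; apply: wp_assign_seq; rewrite ?evalE.
  have lstS : mkseq (rd (set_mem st1 aLst' (reg st1 vLen) (rd st aLst i)) aLst')
       (reg st1 vLen + 1) = filter (predC chg) (mkseq (rd st aLst) i.+1).
    rewrite addn1 [in RHS]mkseqS [in RHS]filter_rcons.
    have -> : predC chg (rd st aLst i) = true by rewrite /= ch.
    by apply: mkseq_rcons lst1 => k; rewrite rd_set_mem.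
  have lenS : reg st1 vLen + 1 =
      size (filter (predC chg) (mkseq (rd st aLst) i.+1)).
    by rewrite -lstS size_mkseq.
  apply: wp_if; rewrite ?evalE /= ri reg1 addn1 => ip;
    [apply: wp_assign|apply: wp_skip]; split; rewrite /= ?evalE
      //= posS pos1 ch.
    by case: (i < _) ip.
  by case: (i < _) ip => //; rewrite addn0.
move=> st1 fr1 [len1 pos1 lst1].
have pos1E : reg st1 vPos' = count (predC chg) (take pos.+1 lst).
  rewrite pos1; congr count; case: (leqP pos.+1 m) => // mp.
  by rewrite !take_oversize // /lst size_mkseq // ltnW.
rewrite -/lst -/kept in len1 lst1.
apply: wp_seq.
  apply: (@wp_for_inv _ _ _ _ _ _ m' (fun k st' =>
    reg st' vLen = size kept + size (filter chg (iota 0 k)) /\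
    mkseq (rd st' aLst') (reg st' vLen) = kept ++ filter chg (iota 0 k))) => //.
  - by move=> st' ag; rewrite evalE (proj1 ag) // (proj1 fr1).
  - by rewrite /= addn0 cats0.
  move=> i st2 lin ri ag [len2 lst2].
  have iotaS : iota 0 i.+1 = rcons (iota 0 i) i.
    by rewrite -addn1 iotaD cats1.
  have chg2 : rd st2 aChg i = rd st aChg i.
    by rewrite (rd_agree ag) // (rd_agree fr1).
  apply: wp_if; rewrite ?evalE ri chg2 => ch; last first.
    by apply: wp_skip; rewrite iotaS filter_rcons /chg ch.
  (* Block [i] is itself changed, so the list built so far is strictly shorter than the final one,
     of length [m']. *)
  have len_lt : reg st2 vLen < p.
    apply: leq_trans m'p; rewrite -sizeE len2 -size_filter ltn_add2l.
    have -> : iota 0 m' = rcons (iota 0 i) i ++ iota i.+1 (m' - i.+1).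
      by rewrite -iotaS -{2}[i.+1]add0n -iotaD subnKC.
    by rewrite filter_cat filter_rcons -/(chg i) /=
      [chg i]ch size_cat size_rcons leq_addr.
  apply: wp_store_seq; rewrite ?evalE // ri; apply: wp_assign; rewrite ?evalE.
  rewrite iotaS filter_rcons [chg i]ch size_rcons (addnS (size kept)) -len2.
  rewrite reg_set_mem addn1; split=> //.
  rewrite reg_set_reg /=.
  rewrite -rcons_cat; apply: mkseq_rcons lst2 => k.
  by rewrite ?updE.
move=> st2 fr2 [len2 lst2].
have lenE : reg st2 vLen = m' by rewrite len2 size_filter sizeE.
rewrite lenE in lst2.
apply: wp_seq.
  apply: (@wp_for_inv _ _ _ _ _ _ m' (fun k st' =>
    forall i, i < k -> rd st' aLst i = rd st2 aLst' i)) => //.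
    by move=> st' ag; rewrite evalE (proj1 ag) // (proj1 fr2) // (proj1 fr1).
  move=> i st3 lin ri ag I3; apply: wp_store; rewrite ?evalE ri.
    exact: leq_trans m'p.
  move=> k /ltnS_eqVlt ki; rewrite ?updE /= (rd_agree ag) //.
  by have [->//|/negbTE ne] := eqVneq k i; apply: I3; lia.
move=> st3 fr3 I3; apply: wp_assign_seq; apply: wp_assign; rewrite ?evalE /=.
split.
- by rewrite !(proj1 fr3) // !(proj1 fr2) // !(proj1 fr1).
- by rewrite !(proj1 fr3) // !(proj1 fr2).
rewrite -lst2; apply/eq_in_map => i; rewrite mem_iota add0n => /andP[_ im].
by rewrite ?updE I3.
Qed.

(** The third hypothesis bounds by [p] every family of states with pairwise different labels;
    applied to the representatives found so far, it bounds the number of blocks during the whole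
    construction. *)
Lemma wp_initialize st :
  let lab := label_sub inp in
  let same_lab i j := lab i j && lab j i in
  (forall i, i < n -> lab i i) ->
  (forall i j k, i < n -> j < n -> k < n -> lab i j -> lab j k -> lab i k) ->
  (forall f m, (forall j, j < m -> f j < n) ->
     (forall j k, j < m -> k < m -> same_lab (f j) (f k) -> j = k) ->
     m <= p) ->
  wp initialize st (fun st' =>
    let m := reg st' vNum in let blk := rd st' aBlk in
    [/\ reg st' vPos = 0, mkseq (rd st' aLst) m = iota 0 m,
        forall s, s < n -> blk s < m,
        forall b, b < m -> exists2 s, s < n & blk s = b &
        forall s t, s < n -> t < n ->
          (rd st' aRel (blk s * m + blk t) != 0) = lab s t /\
          (same_lab s t -> blk s = blk t)]).
Proof.
move=> lab same_lab lab_refl lab_trans card_le.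
have sameC i j : same_lab i j = same_lab j i by rewrite /same_lab andbC.
have same_trans i j k : i < n -> j < n -> k < n ->
    same_lab i j -> same_lab j k -> same_lab i k.
  move=> lin jn kn /andP[ij ji] /andP[jk kj].
  by rewrite /same_lab (lab_trans i j k) // (lab_trans k j i).
(* Representatives have pairwise different labels, and each of the first [k] states is attached to a
   representative with the same label. *)
pose classes st' k :=
  [/\ forall j, j < reg st' vNum -> rd st' aRep j < k,
      forall j l, j < reg st' vNum -> l < reg st' vNum ->
        same_lab (rd st' aRep j) (rd st' aRep l) -> j = l &
      forall s, s < k -> rd st' aBlk s < reg st' vNum /\
        same_lab (rd st' aRep (rd st' aBlk s)) s].
have num_le st' k : k <= n -> classes st' k -> reg st' vNum <= p.
  move=> kn [rep_lt rep_inj _]; apply: card_le rep_inj => j jm.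
  exact: leq_trans (rep_lt j jm) kn.
apply: wp_assign_seq; rewrite ?evalE; apply: wp_seq.
  apply: (@wp_for_inv _ _ _ _ _ _ n (fun k st' => classes st' k)) => //.
  move=> i st1 lin ri ag cl1; have [rep1 inj1 blk1] := cl1.
  have mp := num_le _ _ (ltnW lin) cl1.
  set m := reg st1 vNum in mp rep1 inj1 blk1.
  have rep_n j : j < m -> rd st1 aRep j < n.
    by move=> /rep1 ji; apply: ltn_trans lin.
  apply: wp_assign_seq; rewrite ?evalE -/m; apply: wp_seq.
    (* Either none of the first [k] representatives matches and [vVal] still holds [m], or [vVal]
       points to a match. *)
    apply: (@wp_for_inv _ _ _ _ _ _ m (fun k st' =>
      (reg st' vVal = m /\ forall j, j < k -> ~~ same_lab (rd st1 aRep j) i)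
      \/ (reg st' vVal < m /\ same_lab (rd st1 aRep (reg st' vVal)) i))) => //.
    - by move=> st' [r _]; rewrite evalE r.
    - by left.
    - move=> j st2 jm rj ag2 I2.
      apply: wp_if; rewrite ?evalE ?boolE (proj1 ag2) // rj (rd_agree ag2) //;
        rewrite ?updE /= ri -/lab -/(same_lab i (rd st1 aRep j)) sameC => sij.
        have {}sij : same_lab (rd st1 aRep j) i by case: (same_lab _ _) sij.
        by apply: wp_assign; right; rewrite ?updE ?evalE /= rj.
      have {}sij : ~~ same_lab (rd st1 aRep j) i by case: (same_lab _ _) sij.
      apply: wp_skip; rewrite ?updE /=; case: I2 => [[v2 no2]|[v2 yes2]].
        left; split=> // k /ltnS_eqVlt kj.
        by have [->//|/negbTE ne] := eqVneq k j; apply: no2; lia.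
      by right.
  move=> st2 fr2 I2; have [num2 i2 rep2 blk2] : [/\ reg st2 vNum = m,
      reg st2 vI = i, rd st2 aRep = rd st1 aRep & rd st2 aBlk = rd st1 aBlk].
    by rewrite !(proj1 fr2) // !(rd_agree fr2).
  apply: wp_store_seq; rewrite ?evalE i2 //.
  apply: wp_if; rewrite ?evalE ?updE num2 => val; case: I2 => -[v2 s2];
    rewrite ?v2 ?eqxx // in val *; try by move: val; rewrite (ltn_eqF v2).
    have repS : forall j k, j < m.+1 -> k < m.+1 ->
        same_lab (if j == m then i else rd st1 aRep j)
          (if k == m then i else rd st1 aRep k) -> j = k.
      move=> j k jm km; have [->|jne] := eqVneq j m;
        have [->//|kne] := eqVneq k m.
      - by rewrite sameC (negbTE (s2 k _)) //; lia.
      - by rewrite (negbTE (s2 j _)) //; lia.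
      - by apply: inj1; lia.
    (* The family enlarged by [i] still has pairwise different labels, so its size [m + 1] is at
       most [p]. *)
    have mp' : m < p.
      apply: card_le repS => j jm; case: eqP => // jne.
      by apply: rep_n; lia.
    apply: wp_store_seq; rewrite ?evalE ?updE num2 //.
    apply: wp_assign; rewrite ?evalE ?updE /= num2 addn1 i2; split.
    - move=> j; rewrite ?updE /= ?updE /= => jm.
      by case: eqP => // jne; rewrite rep2 ltnS ltnW // rep1; lia.
    - by move=> j k; rewrite ?updE /= rep2; apply: repS.
    - move=> s /ltnS_eqVlt si; rewrite ?updE /= rep2 blk2.
      have [->|/negbTE ne] := eqVneq s i.
        by rewrite eqxx /same_lab lab_refl.
      have [|bs rs] := blk1 s; first by lia.
      by rewrite (ltn_eqF bs) ltnW.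
  apply: wp_skip; split; rewrite ?updE /= num2.
  - by move=> j; rewrite ?updE rep2 ltnS => /rep1 /ltnW.
  - by move=> j k; rewrite ?updE /= rep2; apply: inj1.
  - move=> s /ltnS_eqVlt si; rewrite ?updE /= rep2 blk2.
    have [->|/negbTE ne] := eqVneq s i; first by [].
    by apply: blk1; lia.
move=> st1 fr1 cl1; have mp := num_le _ _ (leqnn n) cl1.
have {cl1} [rep1 inj1 blk1] := cl1.
set m := reg st1 vNum in mp rep1 inj1 blk1.
set lab' := fun i j => lab (rd st1 aRep i) (rd st1 aRep j).
apply: wp_seq.
  apply: (@wp_for_inv _ _ _ _ _ _ m (fun k st' =>
    (forall i, i < k -> rd st' aLst i = i) /\
    (forall i j, i < k -> j < m -> rd st' aRel (i * m + j) = lab' i j))) => //.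
    by move=> st' [r _]; rewrite evalE r.
  move=> i st2 lin ri ag [lst2 rel2].
  have num2 : reg st2 vNum = m by rewrite (proj1 ag).
  apply: wp_store_seq; rewrite ?evalE ri; first exact: leq_trans mp.
  apply: (@wp_for _ _ _ _ _ _ m (fun k st' =>
    [/\ forall j, j < i.+1 -> rd st' aLst j = j,
        forall l j, l < i -> j < m -> rd st' aRel (l * m + j) = lab' l j &
        forall j, j < k -> rd st' aRel (i * m + j) = lab' i j])) => //.
  - by move=> st' [r _]; rewrite evalE r.
  - split=> // j /ltnS_eqVlt ji; rewrite ?updE /=.
    by have [//|/negbTE ne] := eqVneq j i; apply: lst2; lia.
  - move=> j st3 jm rj ag3 [lst3 rel3 row3].
    have [num3 i3] : reg st3 vNum = m /\ reg st3 vI = i.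
      by rewrite !(proj1 ag3).
    have rep3 : rd st3 aRep = rd st1 aRep.
      by rewrite (rd_agree ag3) // -(rd_agree ag).
    apply: wp_store; rewrite ?evalE i3 rj num3; first exact: pair_index_lt mp.
    rewrite rep3 -/lab -/(lab' i j); split.
    + by move=> k ki; rewrite ?updE /= lst3.
    + move=> k l ki lm; rewrite ?updE /= eq_pair_index // (ltn_eqF ki).
      exact: rel3.
    + move=> k /ltnS_eqVlt kj; rewrite ?updE /= eqn_add2l.
      by have [->//|/negbTE ne] := eqVneq k j; apply: row3; lia.
  - move=> st3 _ [lst3 rel3 row3]; split; first by move=> j ji;
      rewrite ?updE lst3.
    move=> k l /ltnS_eqVlt ki lm; rewrite ?updE.
    have [->|/negbTE ne] := eqVneq k i; first exact: row3.
    by apply: rel3; lia.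
move=> st2 fr2 [lst2 rel2].
have [num2 blk2] : reg st2 vNum = m /\ rd st2 aBlk = rd st1 aBlk.
  by rewrite !(proj1 fr2) // (rd_agree fr2).
have rep_n j : j < m -> rd st1 aRep j < n by exact: rep1.
apply: wp_assign; rewrite ?evalE ?updE /= num2 blk2; split=> //.
- rewrite -[RHS]map_id; apply/eq_in_map => i; rewrite mem_iota => /andP[_ im].
  by rewrite ?updE lst2.
- by move=> s sn; have [] := blk1 s sn.
- move=> b bm; exists (rd st1 aRep b); first exact: rep_n.
  by have [bl same] := blk1 _ (rep_n b bm); apply: inj1.
move=> s t sn tn; have [[sm ss] [tm tt]] := (blk1 s sn, blk1 t tn); split.
  (* The matrix compares representatives; transitivity carries the comparison to [s] and [t] and
     back. *)
  rewrite ?updE rel2 // eqb0 negbK; move: ss tt => /andP[ss ss'] /andP[tt tt'].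
  have [rsn rtn] := (rep_n _ sm, rep_n _ tm); apply/idP/idP => [st_|st_].
    apply: (lab_trans _ _ _ _ _ _ ss' _) => //.
    exact: (lab_trans _ _ _ _ _ _ st_ tt).
  apply: (lab_trans _ _ _ _ _ _ ss _) => //.
  exact: (lab_trans _ _ _ _ _ _ st_ tt').
move=> same_st; apply: inj1 => //.
apply: (same_trans _ _ _ _ _ _ ss _) => //; try exact: rep_n.
apply: (same_trans _ _ _ _ _ _ same_st _) => //; first exact: rep_n.
by rewrite sameC.
Qed.

End Program.

(** * Simulation and domains *)

Section Simulation.
Variable K : kripke.
Let W := world K.

(** * The simulation preorder and its classes *)

Definition sim (s s' : W) : bool :=
  [exists R : {set W * W}, simulation R && ((s, s') \in R)].

Lemma simulationP (R : {set W * W}) :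
  reflect (forall s s', (s, s') \in R -> label s' \subset label s /\
             forall t, trans s t -> exists2 t', trans s' t' & (t, t') \in R)
          (simulation R).
Proof.
apply: (iffP forallP) => [simR s s' ss'|simR s].
  have /forallP/(_ s')/implyP/(_ ss')/andP[lab /forallP step] := simR s.
  split=> // t st; have /implyP/(_ st)/existsP[t' /andP[]] := step t.
  by exists t'.
apply/forallP => s'; apply/implyP => /simR[-> step]; apply/forallP => t.
apply/implyP => /step[t' st' tt']; apply/existsP; exists t'; exact/andP.
Qed.

(** Coinduction principle: the graph of [r] is itself a simulation. *)
Lemma sim_greatest (r : rel W) :
  (forall s s', r s s' -> label s' \subset label s) ->
  (forall s s' t, r s s' -> trans s t -> exists2 t', trans s' t' & r t t') ->
  subrel r sim.
Proof.
move=> lab step s s' rss'; apply/existsP; exists [set x | r x.1 x.2].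
rewrite inE rss' andbT; apply/simulationP => u u'; rewrite inE /= => ruu'.
split=> [|t /(step _ _ _ ruu')[t' ut' rtt']]; first exact: lab.
by exists t'; rewrite ?inE.
Qed.

Lemma sim_label s s' : sim s s' -> label s' \subset label s.
Proof. by case/existsP=> R /andP[/simulationP simR /simR[]]. Qed.

Lemma sim_step s s' t :
  sim s s' -> trans s t -> exists2 t', trans s' t' & sim t t'.
Proof.
case/existsP=> R /andP[simR ss'] st.
have [_ /(_ t st)[t' st' tt']] := simulationP _ simR _ _ ss'.
by exists t' => //; apply/existsP; exists R; rewrite simR.
Qed.

Lemma sim_refl : reflexive sim.
Proof.
move=> s; apply: (@sim_greatest eq_op) => // [u u' /eqP-> //|u u' t /eqP<-].
by exists t.
Qed.

Lemma sim_trans : transitive sim.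
Proof.
(* The composition of [sim] with itself is shown to be a simulation. *)
move=> y x z xy yz; pose r x z := [exists y, sim x y && sim y z].
apply: (@sim_greatest r); last by apply/existsP; exists y; rewrite xy.
  move=> s s' /existsP[u /andP[/sim_label su /sim_label us']].
  exact: subset_trans us' su.
move=> s s' t /existsP[u /andP[su us']] /(sim_step su)[v uv tv].
have [t' st' vt'] := sim_step us' uv.
by exists t' => //; apply/existsP; exists v; rewrite tv.
Qed.

Lemma sim_equivE s s' : sim_equiv s s' = sim s s' && sim s' s.
Proof. by []. Qed.

Lemma sim_equiv_rel : {in [set: W] & &, equivalence_rel (@sim_equiv K)}.
Proof.
move=> x y z _ _ _; rewrite !sim_equivE sim_refl; split=> // /andP[xy yx].
by apply/andP/andP => -[xz zx]; split; apply: sim_trans; eassumption.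
Qed.

(** Inequivalent states lie in different classes. This is the source of every bound by [p], for the
    label classes as well as for the later blocks. *)
Lemma card_sim_inequiv m (f : nat -> W) :
  (forall i j, i < m -> j < m -> sim_equiv (f i) (f j) -> i = j) ->
  m <= #|P_sim K|.
Proof.
move=> inj; have part := equivalence_partitionP sim_equiv_rel.
rewrite -(size_mkseq (fun i => pblock (P_sim K) (f i)) m) cardE.
apply: uniq_leq_size => [|B].
  rewrite map_inj_in_uniq ?iota_uniq // => i j.
  rewrite !mem_iota /= => lim ljm eq_ij; apply: inj => //.
  rewrite -(pblock_equivalence_partition sim_equiv_rel) ?inE // eq_ij.
  by rewrite mem_pblock (cover_partition part) inE.
case/mapP=> i _ ->; rewrite mem_enum pblock_mem //.
by rewrite (cover_partition part) inE.
Qed.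

(** Pairs of classes are counted as pairs of representatives, one state for each class. *)
Definition sim_reps : {set W} := transversal (P_sim K) [set: W].

Lemma card_sim_reps : #|sim_reps| = #|P_sim K|.
Proof.
apply: (@card_transversal _ _ _ [set: W]); apply: transversalP.
exact: equivalence_partitionP sim_equiv_rel.
Qed.

Lemma sim_repsP s : exists2 x, x \in sim_reps & sim_equiv s x.
Proof.
have part := equivalence_partitionP sim_equiv_rel.
have trT := transversalP part.
pose B := pblock (P_sim K) s.
have PB : B \in P_sim K by rewrite pblock_mem // (cover_partition part) inE.
exists (transversal_repr s sim_reps B);
  first exact: repr_mem_transversal trT _ _ PB.
rewrite -(pblock_equivalence_partition sim_equiv_rel) ?inE //.
exact: repr_mem_pblock trT _ _ PB.
Qed.

(* [R u t] means that the block of [t] is included in the image of the block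
   of [u]. *)
Record represents (blk : W -> nat) (m : nat) (R : rel W) : Prop := Represents {
  blk_lt : forall s, blk s < m;
  blk_onto : forall b, b < m -> exists s, blk s = b;
  order_trans : transitive R;
  order_eq : forall s s', R s s' && R s' s = (blk s == blk s');
  order_sim : subrel sim R;
  order_label : forall s s', R s s' -> label s' \subset label s
}.

Lemma order_refl blk m R s s' :
  represents blk m R -> blk s = blk s' -> R s s'.
Proof. by move=> rep /eqP; rewrite -(order_eq rep) => /andP[]. Qed.

Lemma blk_sim_equiv blk m R s s' :
  represents blk m R -> sim_equiv s s' -> blk s = blk s'.
Proof.
move=> rep; rewrite sim_equivE => /andP[ss' s's].
by apply/eqP; rewrite -(order_eq rep) !(order_sim rep).
Qed.

(** As [R] contains [sim], equivalent states share a block; so states chosen from different blocks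
    are inequivalent. *)
Lemma represents_le blk m R : represents blk m R -> m <= #|P_sim K|.
Proof.
move=> rep; have [->//|m0] := posnP m; have [s0 _] := blk_onto rep m0.
(* The default [s0] only makes the choice total; it is never taken for [b < m], as blocks are
   nonempty. *)
apply: (@card_sim_inequiv m (fun b => odflt s0 [pick s | blk s == b])).
suff fK b : b < m -> blk (odflt s0 [pick s | blk s == b]) = b.
  by move=> i j im jm /(blk_sim_equiv rep); rewrite !fK.
case: pickP => [s /eqP //|none /(blk_onto rep)[s sb]].
by have := none s; rewrite sb eqxx.
Qed.

(* The blocks already scanned have an image whose predecessors are expressible
   in the current domain. *)
Definition scanned_ok (blk : W -> nat) (R : rel W) (scanned : seq nat) :=
  forall u s s' t, blk u \in scanned -> R s s' -> trans s t -> R u t ->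
  exists2 t', trans s' t' & R u t'.

Lemma scanned_all_sim blk m R lst :
  represents blk m R -> perm_eq lst (iota 0 m) -> scanned_ok blk R lst ->
  R =2 sim.
Proof.
move=> rep lstP ok s s'; apply/idP/idP => [|ss'];
  last exact: order_sim rep _ _ ss'.
apply: sim_greatest s s' => [s s'|s s' t ss' st]; first exact:
  (order_label rep).
(* The scanned block is taken to be that of [t], which lies in its own image. *)
have tt : R t t by apply: order_refl rep _.
apply: ok ss' st tt.
by rewrite (perm_mem lstP) mem_iota /= (blk_lt rep).
Qed.

Definition ordered_pairs (R : rel W) : {set W * W} :=
  [set x | [&& x.1 \in sim_reps, x.2 \in sim_reps & R x.1 x.2]].

Lemma card_ordered_pairs R : #|ordered_pairs R| <= #|P_sim K| * #|P_sim K|.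
Proof.
rewrite -card_sim_reps -cardsX; apply: subset_leq_card; apply/subsetP => x.
by rewrite !inE => /and3P[-> ->].
Qed.

Definition weight (R : rel W) (m pos : nat) := #|ordered_pairs R| + (m - pos).

(** * One refinement step *)

Section Refine.
Variables (blk : W -> nat) (m : nat) (R : rel W) (lst : seq nat) (pos : nat).
Variables (cur : W) (blk' : W -> nat) (m' : nat) (chg : pred nat).
Let pre s := [exists t, trans s t && R cur t].
(** Both cases of the update of the order in one formula: the image of [s] is cut down to [pre]
    exactly when [s] lies in [pre]. *)
Let R' s s' := R s s' && (pre s ==> pre s').

Hypotheses (rep : represents blk m R) (mm' : m <= m').
Hypothesis blk'_lt : forall s, blk' s < m'.
Hypothesis blk'_onto : forall b, b < m' -> exists s, blk' s = b.
Hypothesis blk'_eq : forall s s',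
  (blk' s == blk' s') = (blk s == blk s') && (pre s == pre s').

(** The image of [cur] is closed under [sim], since [R] is transitive and contains [sim]. *)
Lemma pre_sim s s' : sim s s' -> pre s -> pre s'.
Proof.
move=> ss' /existsP[t /andP[st ct]]; have [t' st' tt'] := sim_step ss' st.
apply/existsP; exists t'; rewrite st' (order_trans rep ct) //.
exact: order_sim rep _ _ tt'.
Qed.

(** The new order is the intersection of [R] with the preorder comparing membership in [pre]; both
    are transitive and contain [sim], and the equivalence it induces is that of [blk']. *)
Lemma represents_refine : represents blk' m' R'.
Proof.
split=> //.
- move=> y x z /andP[xy pxy] /andP[yz pyz]; rewrite /R' (order_trans rep xy)
    //=.
  by apply/implyP => /(implyP pxy)/(implyP pyz).
- move=> s s'; rewrite blk'_eq -(order_eq rep) /R'.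
  by case: (pre s); case: (pre s'); rewrite /= ?andbT ?andbF.
- move=> s s' ss'; rewrite /R' (order_sim rep) //=.
  by apply/implyP; apply: pre_sim.
- by move=> s s' /andP[/(order_label rep)].
Qed.

Hypotheses (lst_perm : perm_eq lst (iota 0 m)) (pos_lt : pos < m).
Hypothesis cur_pos : blk cur = nth 0 lst pos.
Hypothesis scanned : scanned_ok blk R (take pos lst).
Hypothesis blk'_old : forall s, blk' s < m -> blk' s = blk s.
Hypothesis chgE : forall u,
  chg (blk' u) = [exists t, [&& R u t, pre u & ~~ pre t]].
Hypothesis chg_fresh : forall b, m <= b < m' -> chg b.
Let kept := filter (predC chg) lst.
Let lst' := kept ++ filter chg (iota 0 m').
Let pos' := count (predC chg) (take pos.+1 lst).

(** All fresh blocks count as changed, so the unchanged ones are exactly those kept from the old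
    list. *)
Lemma perm_refine : perm_eq lst' (iota 0 m').
Proof.
rewrite perm_sym -(perm_filterC (predC chg) (iota 0 m')) /lst' perm_cat //.
  2: by apply/permP => a; congr count; apply: eq_filter => b /=; rewrite negbK.
rewrite -(subnKC mm') iotaD filter_cat add0n.
rewrite (_ : filter _ (iota m _) = [::]) ?cats0 ?perm_filter // 1?perm_sym //.
apply/eqP; rewrite -[_ == _]negbK -has_filter; apply/hasPn => b.
by rewrite mem_iota subnKC // => /chg_fresh /= ->.
Qed.

Lemma size_refine : size kept + count chg (iota 0 m') = m'.
Proof.
by rewrite -size_filter -size_cat (perm_size perm_refine) size_iota.
Qed.

Lemma pos_refine : pos' <= m'.
Proof.
rewrite -size_refine size_filter /pos' -{2}(cat_take_drop pos.+1 lst) count_cat.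
by rewrite -addnA leq_addr.
Qed.

Lemma take_kept : take pos' lst' = filter (predC chg) (take pos.+1 lst).
Proof.
rewrite /lst' /kept -{1}(cat_take_drop pos.+1 lst) filter_cat -catA.
by rewrite take_size_cat // size_filter.
Qed.

Lemma R'_kept u t : ~~ chg (blk' u) -> R' u t = R u t.
Proof.
rewrite chgE => /existsPn/(_ t); rewrite /R'.
by case: (R u t); case: (pre u); case: (pre t).
Qed.

(** A kept block has its old number and its old image. If it was scanned before, the old invariant
    applies, as [R'] is included in [R]; if it is the current block, the clause on [pre] in [R'] is
    what is required. *)
Lemma scanned_refine : scanned_ok blk' R' (take pos' lst').
Proof.
move=> u s s' t; rewrite take_kept mem_filter => /andP[/= nchg in_take].
have in_lst : blk' u \in lst by apply: mem_take in_take.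
have old : blk' u = blk u.
  by apply: blk'_old; move: in_lst; rewrite (perm_mem lst_perm) mem_iota.
rewrite (R'_kept _ nchg) => /andP[ss' pss'] st ut.
suff [t' st' ut'] : exists2 t', trans s' t' & R u t'.
  by exists t'; rewrite ?(R'_kept _ nchg).
have size_lst : size lst = m by rewrite (perm_size lst_perm) size_iota.
move: in_take; rewrite old (take_nth 0) ?size_lst // mem_rcons inE -cur_pos.
case/predU1P => [uc|]; last by move=> ok; apply: scanned ok ss' st ut.
have uR : R u =1 R cur.
  move=> x; apply/idP/idP; apply: (order_trans rep); exact: order_refl rep _.
(* The image of [u] is that of [cur], so [s] lies in [pre], hence [s'] too, and this provides the
   matching move. *)
have ps : pre s by apply/existsP; exists t; rewrite st -uR.
have /existsP[t' /andP[st' ct']] := implyP pss' ps.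
by exists t'; rewrite ?uR.
Qed.

(** Each changed block occurs as the block of the first component of some lost pair, so there are at
    least as many lost pairs as changed blocks. *)
Lemma ordered_pairs_refine :
  #|ordered_pairs R'| + count chg (iota 0 m') <= #|ordered_pairs R|.
Proof.
pose lost := ordered_pairs R :\: ordered_pairs R'.
have sub : ordered_pairs R' \subset ordered_pairs R.
  by apply/subsetP => x; rewrite !inE => /and3P[-> -> /andP[->]].
have <- : #|ordered_pairs R'| + #|lost| = #|ordered_pairs R|.
  by rewrite cardsD (setIidPr sub) subnKC // subset_leq_card.
rewrite leq_add2l -size_filter cardE -(size_map (fun x => blk' x.1)).
apply: uniq_leq_size => [|b]; first by rewrite filter_uniq ?iota_uniq.
rewrite mem_filter mem_iota /= => /andP[+ /blk'_onto[u ub]].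
rewrite -ub chgE => /existsP[t /and3P[ut pu npt]].
(* The lost pair is moved to representatives, which stay in the same new blocks and hence agree with
   [u] and [t] on old blocks and on [pre]. *)
have [x xT ux] := sim_repsP u; have [y yT ty] := sim_repsP t.
have rep' := represents_refine.
have xb : blk' x = blk' u by rewrite -(blk_sim_equiv rep' ux).
have yb : blk' y = blk' t by rewrite -(blk_sim_equiv rep' ty).
apply/mapP; exists (x, y) => //; rewrite mem_enum !inE /= xT yT /=.
have [bx px] : blk x = blk u /\ pre x = pre u.
  by move/eqP: xb; rewrite blk'_eq => /andP[/eqP ? /eqP ?].
have [yt py] : blk y = blk t /\ pre y = pre t.
  by move/eqP: yb; rewrite blk'_eq => /andP[/eqP ? /eqP ?].
rewrite /R' px py pu (negbTE npt) andbF /=.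
apply: (order_trans rep (order_refl rep bx)).
by apply: (order_trans rep ut); apply: order_refl rep _.
Qed.

(** At most [m - pos - 1] unscanned blocks are kept, and the changed blocks put back at the end are
    paid for by the lost pairs. *)
Lemma weight_refine : weight R' m' pos' < weight R m pos.
Proof.
have size_lst : size lst = m by rewrite (perm_size lst_perm) size_iota.
have kept_le : size kept <= pos' + (m - pos.+1).
  rewrite size_filter -(cat_take_drop pos.+1 lst) count_cat.
  by rewrite leq_add2l -size_lst -size_drop count_size.
have := ordered_pairs_refine; have := size_refine; rewrite /weight; lia.
Qed.

End Refine.

End Simulation.

(** * The main loop *)

Section Main.
Variables (K : kripke) (E : seq (world K * world K)).
Hypothesis EP : E =i transitions K.
Let W := world K.
Let inp := input_of E.
Let n := #|W|.
Let p := #|P_sim K|.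
Let wp c st Q :=
  wp inp (capacity n p) (iterations n (size (edges inp)) p) c st Q.

(** * States and transitions as numbers *)

Lemma num_lt (s : W) : num s < n. Proof. exact: ltn_ord. Qed.

Lemma num_inj : injective (@num K).
Proof. by move=> s t /ord_inj/enum_rank_inj. Qed.

Lemma num_onto i : i < n -> exists s : W, num s = i.
Proof.
by move=> lin; exists (enum_val (Ordinal lin)); rewrite /num enum_valK.
Qed.

Lemma has_num (a : pred nat) : has a (iota 0 n) = [exists s : W, a (num s)].
Proof.
apply/hasP/existsP => [[i]|[s as_]].
  by rewrite mem_iota => /num_onto[s <-]; exists s.
by exists (num s); rewrite ?mem_iota ?num_lt.
Qed.

Lemma has_edge (s : W) (a : pred nat) :
  has (fun e => (e.1 == num s) && a e.2) (edges inp) =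
  [exists t : W, trans s t && a (num t)].
Proof.
rewrite /inp /= has_map; apply/hasP/existsP => [[[u v]]|[t /andP[st at_]]].
  rewrite EP inE /= => uv /andP[/eqP/num_inj <- av].
  by exists v; rewrite uv.
by exists (s, t); rewrite ?EP ?inE //= eqxx.
Qed.

Lemma edge_source_lt e : e \in edges inp -> e.1 < n.
Proof. by case/mapP => st _ -> /=; apply: num_lt. Qed.

Lemma label_sub_num (s t : W) :
  label_sub inp (num s) (num t) = (label s \subset label t).
Proof.
rewrite /inp /=; have labE (u : W) :
    nth set0 [seq label v | v <- enum W] (num u) = label u.
  by rewrite (nth_map u) ?nth_enum_rank // -cardE num_lt.
by rewrite !labE.
Qed.

(** * The new block numbers as a function on states *)

Section SplitBlocks.
Variables (blk : nat -> nat) (pre : nat -> bool) (m : nat).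
Hypothesis blk_lt : forall s : W, blk (num s) < m.
Hypothesis blk_onto : forall b, b < m -> exists s : W, blk (num s) = b.
Let new := fresh inp blk pre m.
Let spl := splits inp blk pre.

Definition split_blk (s : W) :=
  if pre (num s) && spl (blk (num s)) then new (blk (num s)) else blk (num s).

Lemma meetsP b :
  reflect (exists2 s : W, blk (num s) = b & pre (num s)) (meets inp blk pre b).
Proof.
rewrite /meets has_num; apply: (iffP existsP) => [[s /andP[/eqP]]|[s bs ps]].
  by exists s.
by exists s; rewrite bs eqxx.
Qed.

Lemma differsP b :
  reflect (exists2 s : W, blk (num s) = b & ~~ pre (num s))
    (differs inp blk pre b).
Proof.
rewrite /differs has_num; apply: (iffP existsP) => [[s /andP[/eqP]]|[s bs ps]].
  by exists s.
by exists s; rewrite bs eqxx.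
Qed.

(** The function [new] grows by at most one at each block, so fresh numbers leave no gap. *)
Lemma fresh_onto k b : m <= b < new k -> exists2 c, c < k & spl c /\ new c = b.
Proof.
elim: k => [|k IH]; first by rewrite /new /fresh addn0; lia.
rewrite /new freshS -/new -/spl => bm.
have [lt|le] := ltnP b (new k).
  by have [|c ck cP] := IH; [lia | exists c => //; apply: ltnW].
by exists k => //; case: (spl k) bm; rewrite -/(new k) ?addn0 ?addn1; split;
  lia.
Qed.

Lemma split_blk_lt s : split_blk s < new m.
Proof.
rewrite /split_blk; case: ifP => [/andP[_ sb]|_]; first exact: fresh_lt.
by apply: leq_trans (fresh_ge _ _ _ _ _); apply: blk_lt.
Qed.

Lemma split_blk_onto b : b < new m -> exists s, split_blk s = b.
Proof.
move=> bn; have [bm|mb] := ltnP b m.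
  have [sb|nsb] := boolP (spl b).
    have /andP[_ /differsP[s bs ps]] := sb.
    by exists s; rewrite /split_blk (negbTE ps).
  have [s bs] := blk_onto bm; exists s.
  by rewrite /split_blk bs (negbTE nsb) andbF.
have [|c cm [sc <-]] := @fresh_onto m b; first by rewrite mb.
have /andP[/meetsP[s bs ps] _] := sc.
by exists s; rewrite /split_blk bs ps sc.
Qed.

Lemma split_blk_eq s t : (split_blk s == split_blk t) =
  (blk (num s) == blk (num t)) && (pre (num s) == pre (num t)).
Proof.
have new_ne (u v : W) : (new (blk (num u)) == blk (num v)) = false.
  apply/negbTE; have := fresh_ge inp blk pre m (blk (num u)).
  by rewrite -/new; have := blk_lt v; lia.
(* Two states of one block on different sides of [pre] force it to split; so a block that does not
   split lies on one side. *)
have no_split (u v : W) : blk (num u) = blk (num v) -> pre (num u) -> ~~ pre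
  (num v) ->
    spl (blk (num u)).
  move=> uv pu pv; apply/andP; split; first by apply/meetsP; exists u.
  by apply/differsP; exists v.
rewrite /split_blk; case: ifP => [/andP[ps ss]|/negbT nss];
  case: ifP => [/andP[pt st]|/negbT nst].
- by rewrite fresh_inj // ps pt andbT.
- rewrite new_ne; case: eqP nst => //= st; rewrite -st ss andbT => /negbTE pt.
  by rewrite ps pt.
- rewrite eq_sym new_ne; case: eqP nss => //= ts;
    rewrite ts st andbT => /negbTE ps.
  by rewrite ps pt.
- case: eqP => //= st; move: nss nst; rewrite -st.
  case ps: (pre (num s)); case pt: (pre (num t)) => //=.
    by rewrite (no_split s t) ?pt.
  by rewrite st (no_split t s) ?ps.
Qed.

Lemma split_blk_old s : split_blk s < m -> split_blk s = blk (num s).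
Proof.
rewrite /split_blk; case: ifP => // _.
by have := fresh_ge inp blk pre m (blk (num s)); rewrite -/new; lia.
Qed.

End SplitBlocks.

(** * The loop invariant and one scan *)

(** The row is that of [s'] and the column that of [s]: an entry says that the block of its row lies
    in the image of that of its column. *)
Definition state_order (st : state) (s s' : W) : bool :=
  rd st aRel (rd st aBlk (num s') * reg st vNum + rd st aBlk (num s)) != 0.

Definition state_blk (st : state) (s : W) : nat := rd st aBlk (num s).

Definition state_weight (st : state) : nat :=
  weight (state_order st) (reg st vNum) (reg st vPos).

(** The functions [blk] and [R] are matched with the memory only pointwise, so that the refined
    functions can be supplied as they are. *)
Definition loop_inv (st : state) : Prop :=
  exists blk R, let lst := mkseq (rd st aLst) (reg st vNum) in
    [/\ state_blk st =1 blk /\ state_order st =2 R,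
        represents blk (reg st vNum) R, perm_eq lst (iota 0 (reg st vNum)),
        scanned_ok blk R (take (reg st vPos) lst) &
        reg st vPos <= reg st vNum].

Lemma eq_weight (R1 R2 : rel W) m pos :
  R1 =2 R2 -> weight R1 m pos = weight R2 m pos.
Proof.
move=> eqR; congr (_ + _).
by apply: eq_card => x; rewrite !inE eqR.
Qed.

(** The specifications of the program parts supply the hypotheses of the abstract refinement
    step. *)
Lemma wp_scan st :
  loop_inv st -> reg st vPos < reg st vNum ->
  wp (vCur ::= aLst.[vPos] ;; compute_image ;; compute_pre ;; Defs.split ;;
      update_order ;; update_list)%prog st
    (fun st' => loop_inv st' /\ state_weight st' < state_weight st).
Proof.
move=> [blk [R [[state_blkE RE] rep lst_perm scanned _]]] pos_lt.
have blkE (s : W) : rd st aBlk (num s) = blk s := state_blkE s.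
set m := reg st vNum in rep lst_perm scanned pos_lt *.
set pos := reg st vPos in scanned pos_lt *.
set lst := mkseq _ _ in lst_perm scanned.
have mp := represents_le rep.
have [cur cur_pos] : exists cur, blk cur = nth 0 lst pos.
  apply: (blk_onto rep).
  have : nth 0 lst pos \in lst by rewrite mem_nth // size_mkseq.
  by rewrite (perm_mem lst_perm) mem_iota.
pose pre s := [exists t, trans s t && R cur t].
pose R' s s' := R s s' && (pre s ==> pre s').
have ROE s s' : (rd st aRel (blk s' * m + blk s) != 0) = R s s'.
  by rewrite -RE /state_order -!blkE.
apply: wp_assign_seq; rewrite ?evalE.
have -> : rd st aLst (reg st vPos) = blk cur by rewrite cur_pos nth_mkseq.
apply: wp_seq; first exact: (wp_compute_image _ _ mp).
move=> st2 fr2 img2.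
apply: wp_seq; first exact: (wp_compute_pre _ _ edge_source_lt).
move=> st3 fr3 pre3.
have blk3 : rd st3 aBlk = rd st aBlk by rewrite (rd_agree fr3) //
  (rd_agree fr2).
have preE (s : W) : (rd st3 aPre (num s) != 0) = pre s.
  rewrite pre3 ?num_lt // (has_edge s (fun v => rd st2 aImg
    (rd st2 aBlk v) != 0)).
  apply: eq_existsb => t; congr (_ && _).
  have -> : rd st2 aBlk (num t) = blk t by rewrite (rd_agree fr2) // [LHS]blkE.
  by rewrite -ROE img2 // (blk_lt rep).
have num3 : reg st3 vNum = m by rewrite (proj1 fr3) // (proj1 fr2).
pose pren i := rd st3 aPre i != 0.
pose blk' := split_blk (rd st aBlk) pren m.
pose m' := fresh inp (rd st aBlk) pren m m.
have blkn_lt (s : W) : rd st aBlk (num s) < m by rewrite blkE (blk_lt rep).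
have blkn_onto b : b < m -> exists s : W, rd st aBlk (num s) = b.
  by move/(blk_onto rep) => [s <-]; exists s; apply: blkE.
have blk'_lt s : blk' s < m' by apply: split_blk_lt.
have blk'_onto b : b < m' -> exists s, blk' s = b by apply: split_blk_onto.
have blk'_eq s s' :
    (blk' s == blk' s') = (blk s == blk s') && (pre s == pre s').
  by rewrite /blk' split_blk_eq // !blkE /pren !preE.
have blk'_old s : blk' s < m -> blk' s = blk s.
  by move=> /split_blk_old; rewrite blkE.
have mm' : m <= m' by apply: fresh_ge.
have rep' := represents_refine rep blk'_lt blk'_onto blk'_eq.
(* The number of blocks after the split is bounded before the split is run; its stores need this
   bound. *)
have m'p := represents_le rep'.
apply: wp_seq.
  apply: (wp_split (blk := rd st aBlk) (pre := pren) num3 mp m'p) => //.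
    by move=> s _; rewrite blk3.
  by move=> s /num_onto[u <-].
move=> st4 fr4 [num4 blk4 par4 new4].
have {}blk4 (s : W) : rd st4 aBlk (num s) = blk' s by rewrite blk4 // num_lt.
have [par_blk inpre_blk] : (forall s, rd st4 aPar (blk' s) = blk s) /\
    (forall s, (rd st4 aInPre (blk' s) != 0) = pre s).
  have both s : rd st4 aPar (blk' s) = blk s /\
      (rd st4 aInPre (blk' s) != 0) = pre s.
    rewrite -preE -blkE /blk' /split_blk -/(pren (num s)).
    case: ifP => [/andP[ps ss]|nss].
      by have [-> ->] := new4 _ (blkn_lt s) ss; rewrite ps.
    have [-> ->] := par4 _ (blkn_lt s); split=> //; rewrite eqb0 negbK.
    case ps: (pren (num s)) nss => nss /=.
      have mts : meets inp (rd st aBlk) pren (rd st aBlk (num s)).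
        by apply/meetsP; exists s.
      by move: nss; rewrite /= /splits mts /= => ->.
    have -> : differs inp (rd st aBlk) pren (rd st aBlk (num s)).
      by apply/differsP; exists s; rewrite ?ps.
    by rewrite andbF.
  by split=> s; have [] := both s.
have num4' : reg st4 vNum = m by rewrite (proj1 fr4).
have rel4 : rd st4 aRel = rd st aRel.
  by rewrite (rd_agree fr4) // (rd_agree fr3) // (rd_agree fr2).
have lst4 : rd st4 aLst = rd st aLst.
  by rewrite (rd_agree fr4) // (rd_agree fr3) // (rd_agree fr2).
have pos4 : reg st4 vPos = pos.
  by rewrite (proj1 fr4) // (proj1 fr3) // (proj1 fr2).
apply: wp_seq; first exact: (wp_update_order _ num4' num4 m'p).
move=> st5 fr5 [rel5 chg5].
(* Every new block contains a state, so the matrix conditions can be read on states. *)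
have lostE s s' :
    [&& rd st4 aRel (rd st4 aPar (blk' s') * m + rd st4 aPar (blk' s)) != 0,
        rd st4 aInPre (blk' s) != 0 & rd st4 aInPre (blk' s') == 0] =
    [&& R s s', pre s & ~~ pre s'].
  rewrite !par_blk rel4 ROE inpre_blk; congr [&& _, _ & _].
  by rewrite -inpre_blk negbK.
have {}rel5 s s' : (rd st5 aRel (blk' s' * m' + blk' s) != 0) = R' s s'.
  rewrite rel5 // lostE !par_blk rel4 /R'.
  case: ifP => [/and3P[-> -> /negbTE->] //|]; rewrite ROE.
  by case: (R s s'); case: (pre s); case: (pre s').
pose chg b := rd st5 aChg b != 0.
have chgE u : chg (blk' u) = [exists t, [&& R u t, pre u & ~~ pre t]].
  rewrite /chg chg5 //; apply/hasP/existsP => [[b]|[t]].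
    by rewrite mem_iota => /blk'_onto[t <-]; rewrite lostE; exists t.
  by rewrite -lostE => lo; exists (blk' t); rewrite // mem_iota blk'_lt.
(* The inner part of a split block loses the outer part from its image. *)
have chg_fresh b : m <= b < m' -> chg b.
  move=> /fresh_onto[c cm [sc <-]].
  have /andP[/meetsP[s bs ps] /differsP[t bt pt]] := sc.
  have <- : blk' s = fresh inp (rd st aBlk) pren m c.
    by rewrite /blk' /split_blk bs ps sc.
  rewrite chgE; apply/existsP; exists t; rewrite -!preE -/(pren (num s))
    -/(pren (num t)) ps pt !andbT.
  by apply: (order_refl rep); rewrite -!blkE [LHS]bs.
have num5 : reg st5 vNum = m by rewrite (proj1 fr5).
have num5' : reg st5 vNum' = m' by rewrite (proj1 fr5).
have pos5 : reg st5 vPos = pos by rewrite (proj1 fr5).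
have lst5 : rd st5 aLst = rd st aLst by rewrite (rd_agree fr5).
have size5 : size (filter (predC chg) (mkseq (rd st5 aLst) m)) +
    count chg (iota 0 m') = m'.
  by rewrite lst5; apply: (size_refine (m := m)).
apply: (wp_weaken (wp_update_list _ num5 num5' mm' m'p size5)).
move=> st6 fr6 [num6 pos6 lst6]; rewrite pos5 lst5 -/lst -/chg in pos6 lst6.
have blk6 (s : W) : rd st6 aBlk (num s) = blk' s.
  by rewrite (rd_agree fr6) // (rd_agree fr5).
have order6 : state_order st6 =2 R'.
  by move=> s s'; rewrite /state_order !blk6 num6 (rd_agree fr6).
split.
  exists blk', R'; rewrite num6 pos6 lst6; split=> //.
  - exact: (perm_refine (m := m)).
  - by apply: (scanned_refine (blk := blk) (m := m) (cur := cur)) => //.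
  - by apply: (pos_refine (m := m)).
rewrite /state_weight num6 pos6 (eq_weight _ _ order6) (eq_weight _ _ RE).
by apply: (weight_refine (blk := blk) (cur := cur) (blk' := blk')).
Qed.

End Main.

(** * Complexity and correctness *)

(** The cost unfolds to a polynomial; as [p] is positive and [n <= e], its monomials are dominated
    by [p ^ 4] and [p ^ 2 * e]. These comparisons are supplied first, which leaves linear
    arithmetic. *)
Lemma cost_sim_algorithm n e p :
  0 < p -> 0 < n <= e ->
  cost (iterations n e p) sim_algorithm <= 3000 * (p ^ 2 * (p ^ 2 + e)).
Proof.
move=> p0 /andP[n0 ne].
have [p2 p3 p4] : [/\ p <= p * p, p * p <= p * p * p
    & p * p * p <= p * p * p * p] by split; rewrite leq_pmulr.
have [e1 e2] : e <= p * e /\ p * e <= p * p * e.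
  by rewrite -mulnA !leq_pmull.
have [n1 n2] : p * n <= p * e /\ p * p * n <= p * p * e.
  by rewrite !leq_mul2l ne !orbT.
rewrite /= -!mulnn; lia.
Qed.

Section Correctness.
Variables (K : kripke) (E : seq (world K * world K)).
Hypothesis EP : E =i transitions K.
Let inp := input_of E.
Let n := #|world K|.
Let p := #|P_sim K|.
Let wp c st Q :=
  wp inp (capacity n p) (iterations n (size (edges inp)) p) c st Q.

(** The initial order is reverse inclusion of labels, which contains [sim]; at position 0 nothing is
    scanned. Equivalent states have equal labels, so there are at most [p] label classes. *)
Lemma wp_initialize_inv st : wp initialize st (@loop_inv K).
Proof.
have labE := label_sub_num E.
have num_world (i : nat) : i < n -> exists s : world K, num s = i.
  exact: num_onto.
apply: (wp_weaken (wp_initialize st _ _ _)).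
- by move=> i /num_world[s <-]; rewrite labE.
- move=> i j k /num_world[s <-] /num_world[t <-] /num_world[u <-].
  by rewrite !labE; apply: subset_trans.
- move=> f m f_lt f_inj; have [->//|m0] := posnP m.
  have [s0 _] := num_world _ (f_lt 0 m0).
  apply: (@card_sim_inequiv K m (fun j => nth s0 (enum (world K)) (f j))).
  have numE j : j < m -> f j = num (nth s0 (enum (world K)) (f j)).
    move=> /f_lt; rewrite /n => fj; have [s sE] := num_world _ fj.
    by rewrite -sE nth_enum_rank.
  move=> i j im jm; rewrite sim_equivE => /andP[ij ji]; apply: f_inj => //.
  by rewrite (numE i) // (numE j) // !labE !sim_label.
move=> st' _ [pos0 lstE blk_lt blk_onto orderE].
have blk_of b : b < reg st' vNum -> exists s : world K, state_blk st' s = b.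
  by move=> /blk_onto[i /num_world[s <-] <-]; exists s.
have order_lab (s s' : world K) : state_order st' s s' =
  (label s' \subset label s).
  by rewrite /state_order (proj1 (orderE _ _ (num_lt s') (num_lt s))) labE.
exists (state_blk st'), (state_order st'); rewrite pos0 lstE; split=> //.
- split=> //.
  + by move=> s; apply: blk_lt; apply: num_lt.
  + by move=> y x z; rewrite !order_lab => yx zy; apply: subset_trans yx.
  + move=> s s'; rewrite !order_lab; apply/idP/eqP => [/andP[s's ss']|eq_blk].
      apply: (proj2 (orderE _ _ (num_lt s) (num_lt s'))).
      by rewrite !labE ss' s's.
    have := order_lab s' s'; rewrite subxx -!order_lab /state_order.
    rewrite -/(state_blk st' s) -/(state_blk st' s') eq_blk.
    by move=> ->.
  + by move=> s s' /sim_label; rewrite order_lab.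
  + by move=> s s'; rewrite order_lab.
- by rewrite take0.
Qed.

Lemma wp_sim_algorithm :
  wp sim_algorithm init_state (fun st => output K st = P_sim K).
Proof.
apply: wp_seq; first exact: wp_initialize_inv.
move=> st1 _ inv1.
have /wp_weaken : wp (While (Lt vPos vNum) (vCur ::= aLst.[vPos] ;;
    compute_image ;; compute_pre ;; Defs.split ;; update_order ;;
    update_list)%prog) st1
    (fun st => loop_inv K st /\ eval inp st (Lt vPos vNum) = 0).
  (* Initially the weight is at most [p * p] pairs plus [p] blocks. *)
  apply: (wp_while (mu := @state_weight K)) => //.
    have [blk [R [_ rep _ _ _]]] := inv1.
    rewrite /state_weight /weight /= leq_add ?card_ordered_pairs //.
    exact: leq_trans (leq_subr _ _) (represents_le rep).
  move=> st inv; rewrite !evalE eqb0 negbK => pos_lt.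
  exact: wp_scan.
apply=> st _ [[blk [R [[blkE RE] rep lst_perm scanned pos_le]]]].
rewrite !evalE => /eqP; rewrite eqb0 -leqNgt => le_pos.
have R_sim : R =2 @sim K.
  apply: (scanned_all_sim rep lst_perm).
  (* On exit the position is past the end, so the scanned prefix is the whole list. *)
  by move: scanned; rewrite take_oversize ?size_mkseq.
rewrite /output /preim_partition /P_sim /equivalence_partition.
apply: eq_imset => s; apply/setP => s'; rewrite !inE /=.
rewrite -/(rd st aBlk (num s)) -/(rd st aBlk (num s')).
rewrite -!/(state_blk st _) !blkE sim_equivE -!R_sim.
by rewrite -(order_eq rep).
Qed.

(** Nine scalars, two arrays of size [n], two of size [p * p] and ten of size [p]; the constant is
    absorbed because [n] is positive. *)
Lemma space_bound st :
  within (capacity n p) st -> 0 < n -> 0 < p -> space st <= 20 * (n + p ^ 2).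
Proof.
move=> wi n0 p0; have p2 : p <= p * p by rewrite leq_pmulr.
have : space st <= 9 + \sum_(a <- arrs) capacity n p a.
  by rewrite /space leq_add2l leq_sum.
move=> /leq_trans; apply; rewrite /arrs !big_cons big_nil /= -mulnn; lia.
Qed.

(** Totality gives each state a chosen outgoing transition, and distinct states get distinct
    ones. *)
Lemma card_world_transitions : #|world K| <= #|transitions K|.
Proof.
have /fin_all_exists[next nextP] := @trans_total K.
rewrite -(card_imset (world K) (f := fun s => (s, next s))); last first.
  by move=> s t [].
apply: subset_leq_card; apply/subsetP => _ /imsetP[s _ ->].
by rewrite inE nextP.
Qed.

End Correctness.

Theorem theorem5p4 :
  exists c : nat,
  forall (K : kripke) (E : seq (world K * world K)),
    uniq E -> E =i transitions K ->
  exists (st : state) (t : nat),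
    exec (input_of E) sim_algorithm init_state st t /\
    output K st = P_sim K /\
    (0 < #|world K| ->
       space st <= c * (#|world K| + #|P_sim K| ^ 2) /\
       t <= c * (#|P_sim K| ^ 2 * (#|P_sim K| ^ 2 + #|transitions K|))).
Proof.
(* The constant of the time bound; it exceeds the constant 20 of the space bound. *)
exists 3000 => K E uniqE EP.
have [st [t [ex t_le wi out]]] := wp_sim_algorithm EP.
exists st, t; split=> //; split=> // n0.
have p0 : 0 < #|P_sim K|.
  rewrite -card_sim_reps; have [s _] := card_gt0P n0.
  by have [x xT _] := sim_repsP s; apply/card_gt0P; exists x.
(* As [E] has no repetition, its length is the number of transitions. *)
have size_E : size (edges (input_of E)) = #|transitions K|.
  by rewrite size_map -(eq_card EP) (card_uniqP uniqE).
split; last first.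
  apply: leq_trans t_le _; rewrite size_E; apply: cost_sim_algorithm => //.
  by rewrite n0 card_world_transitions.
have /wi/space_bound : within (capacity #|world K| #|P_sim K|) init_state by [].
by move=> /(_ n0 p0)/leq_trans; apply; rewrite leq_mul2r orbC.
Qed.
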